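(* Suppose $E\subseteq\mathbb{R}^{n+1}$ is $(c,\delta,\theta)$-weakly porous for some $c,\delta\in(0,1)$ and $\theta>1$. Then for every $\psi>1$ the set $E$ is $(c,\sigma,\psi)$-weakly porous, where $\sigma=\sigma(n,p,d,c,\delta,\theta,\psi)\in(0,1)$ is a constant with the following property: for any parabolic rectangle $R(\gamma_0)\subseteq\mathbb{R}^{n+1}$ with $0\le\gamma_0\le1/2$ and any $P(\gamma)\in\mathcal{D}_1(R(\gamma_0))$ there exist pairwise disjoint $E$-free rectangles $S_1,\dots,S_N\in\mathcal{D}(P(\gamma))$ with $|S_i|\ge\sigma|\mathcal{M}(R^\psi(\gamma_0))|$ for each $i$ and $\sum_{i=1}^N|S_i|\ge c|P(\gamma)|$. (Such a $\sigma$, depending only on the listed quantities, exists.)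
   Context: Throughout, $n\ge 1$ is an integer, $1<p<\infty$, and $d\ge1$ is a fixed integer with $dp\ge\log_2 9$. Points of $\mathbb{R}^{n+1}$ are written $(x,t)$ with $x\in\mathbb{R}^n$, $t\in\mathbb{R}$; $|\cdot|$ is Lebesgue measure. Parabolic rectangles: for $x\in\mathbb{R}^n$, $t\in\mathbb{R}$, $L>0$, $0\le\gamma\le1/2$, let $Q(x,L)=\prod_{i}[x_i-L/2,x_i+L/2)$ and $R(\gamma)=R(x,t,L,\gamma)=Q(x,L)\times[t-L^p,t-\gamma L^p)$. Side lengths: $l_x(R(\gamma))=L$, $l_t(R(\gamma))=(1-\gamma)L^p$. For $\theta\in\mathbb{R}$, $R^\theta(\gamma)=R(\gamma)+(0,\theta\, l_t(R(\gamma)))$. Dyadic lattice: $\mathcal{D}_1(R(\gamma))$ is the partition of $R(\gamma)$ obtained by dividing each spatial edge into $2^d$ equal half-open intervals and the temporal edge into $k$ equal half-open intervals, where $k=\lceil 2^{dp}\rceil$ if $0\le\gamma\le 1-\frac{2^{dp}+1}{2^{dp+1}}$ and $k=\lfloor2^{dp}\rfloor$ if $1-\frac{2^{dp}+1}{2^{dp+1}}<\gamma\le\frac12$. Its members are again parabolic rectangles with truncation parameter in $[0,1/2]$. Put $\mathcal{D}_0(R(\gamma))=\{R(\gamma)\}$, $\mathcal{D}_{i+1}(R(\gamma))=\bigcup_{P\in\mathcal{D}_i(R(\gamma))}\mathcal{D}_1(P)$, $\mathcal{D}(R(\gamma))=\bigcup_{i\ge0}\mathcal{D}_i(R(\gamma))$.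 Weak porosity: for a nonempty closed $E$, a set $A$ is $E$-free if $A\cap E=\emptyset$. $\mathcal{F}(R(\gamma_0))$ is the collection of maximal (with respect to inclusion) $E$-free members of $\mathcal{D}(R(\gamma_0))$, and $\mathcal{M}(R(\gamma_0))\in\mathcal{F}(R(\gamma_0))$ is a member with largest $l_x$ ($\mathcal{M}(R(\gamma_0))=\emptyset$ if $\mathcal{F}(R(\gamma_0))=\emptyset$). For $c,\delta\in(0,1)$, $\theta\in\mathbb{R}$, a nonempty closed set $E$ is $(c,\delta,\theta)$-weakly porous if for every parabolic rectangle $R(\gamma_0)$ with $0\le\gamma_0\le1/2$ there are finitely many pairwise disjoint $E$-free $P_1,\dots,P_N\in\mathcal{D}(R(\gamma_0))$ with $|P_k|\ge\delta|\mathcal{M}(R^\theta(\gamma_0))|$ for all $k$ and $\sum_{k=1}^N|P_k|\ge c|R(\gamma_0)|$. *)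

(* Defs.v *)
From HB Require Import structures.
From mathcomp Require Import all_boot all_order all_algebra.
From mathcomp Require Import all_classical all_reals all_analysis.
From mathcomp Require Import ring lra.

Set Implicit Arguments.
Unset Strict Implicit.
Unset Printing Implicit Defensive.

Import Order.TTheory GRing.Theory Num.Theory.
Import numFieldNormedType.Exports.

Local Open Scope classical_set_scope.
Local Open Scope ring_scope.

(* Points (x, t) of R^(n+1) are elements of 'rV[R]_n * R. *)

(* n-dimensional Lebesgue measure as an iterated product of the
   one-dimensional one, i.e. by integrating the measures of the sections (as
   in product_measure1).  It is meaningful on Borel sets; below it is only
   applied to boxes and to the empty set. *)
Fixpoint lebesgue_rV (R : realType) (n : nat) : set 'rV[R]_n -> \bar R :=
  match n with
  | 0 => fun A => (\1_A 0)%:E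
  | m.+1 => fun A =>
      (\int[lebesgue_measure]_(x in setT)
         lebesgue_rV [set v : 'rV[R]_m | A (row_mx (x%:M : 'rV[R]_1) v)])%E
  end.

Definition lebesgue_xt (R : realType) (n : nat) (A : set ('rV[R]_n * R)) :
    \bar R :=
  (\int[lebesgue_measure]_(t in setT) lebesgue_rV [set x | A (x, t)])%E.

(* The parameters of R(gamma) = R(x, t, L, gamma). *)
Record prect (R : realType) (n : nat) := PRect {
  pcenter : 'rV[R]_n;
  ptop : R;
  pside : R;
  pgam : R }.

Definition prect_valid (R : realType) (n : nat) (P : prect R n) : Prop :=
  0 < pside P /\ 0 <= pgam P <= 1 / 2.

Definition prect_set (R : realType) (n : nat) (p : R) (P : prect R n) :
    set ('rV[R]_n * R) :=
  [set z : 'rV[R]_n * R | (forall i, pcenter P 0 i - pside P / 2 <= z.1 0 i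
                        < pcenter P 0 i + pside P / 2) /\
           ptop P - pside P `^ p <= z.2 < ptop P - pgam P * pside P `^ p].

Definition l_x (R : realType) (n : nat) (P : prect R n) : R := pside P.

Definition l_t (R : realType) (n : nat) (p : R) (P : prect R n) : R :=
  (1 - pgam P) * pside P `^ p.

Definition pshift (R : realType) (n : nat) (p theta : R) (P : prect R n) :
    prect R n :=
  PRect (pcenter P) (ptop P + theta * l_t p P) (pside P) (pgam P).

Definition nb_t (R : realType) (p : R) (d : nat) (gam : R) : nat :=
  let a : R := 2 `^ (d%:R * p) in
  if gam <= 1 - (a + 1) / 2 `^ (d%:R * p + 1)
  then `|Num.ceil a|%N else `|Num.floor a|%N.

(* The piece of P with spatial position m and temporal position j. Its side is
   L' = L / 2^d, and its top and truncation parameter gamma' are the ones for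
   which [t' - L'^p, t' - gamma' L'^p) is the j-th of the k equal subintervals
   of the temporal edge of P; see prect_set_child. *)
Definition child (R : realType) (n : nat) (p : R) (d : nat) (P : prect R n)
    (m : 'I_n -> 'I_(2 ^ d)) (j : nat) : prect R n :=
  let k : R := (nb_t p d (pgam P))%:R in
  let L' := pside P / 2 ^+ d in
  PRect (\row_i (pcenter P 0 i - pside P / 2 + ((m i)%:R + 1 / 2) * L'))
        (ptop P - pside P `^ p + j%:R * (l_t p P / k) + L' `^ p)
        L'
        (1 - l_t p P / k / L' `^ p).

Definition dyadic1 (R : realType) (n : nat) (p : R) (d : nat) (P : prect R n) :
    set (prect R n) :=
  [set Q | exists (m : 'I_n -> 'I_(2 ^ d)) (j : 'I_(nb_t p d (pgam P))),
     Q = child p P m j].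

Fixpoint dyadic_gen (R : realType) (n : nat) (p : R) (d i : nat)
    (P : prect R n) : set (prect R n) :=
  match i with
  | 0 => [set P]
  | i'.+1 => \bigcup_(Q in dyadic_gen p d i' P) dyadic1 p d Q
  end.

Definition dyadic (R : realType) (n : nat) (p : R) (d : nat) (P : prect R n) :
    set (prect R n) :=
  \bigcup_i dyadic_gen p d i P.

Definition E_free (T : Type) (E A : set T) : Prop := A `&` E = set0.

Definition max_free (R : realType) (n : nat) (p : R) (d : nat)
    (E : set ('rV[R]_n * R)) (P : prect R n) : set (prect R n) :=
  [set Q | [/\ dyadic p d P Q, E_free E (prect_set p Q) &
     forall Q', dyadic p d P Q' -> E_free E (prect_set p Q') ->
       prect_set p Q `<=` prect_set p Q' -> prect_set p Q' = prect_set p Q]].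

(* M(P): a member of F(P) with largest l_x, chosen by xget; the default set0
   is returned when F(P) is empty. *)
Definition largest_free (R : realType) (n : nat) (p : R) (d : nat)
    (E : set ('rV[R]_n * R)) (P : prect R n) : set ('rV[R]_n * R) :=
  xget set0 [set A | exists Q, [/\ max_free p d E P Q,
    forall Q', max_free p d E P Q' -> l_x Q' <= l_x Q & A = prect_set p Q]].

Definition free_family (R : realType) (n : nat) (p : R) (d : nat)
    (E : set ('rV[R]_n * R)) (c : R) (b : \bar R) (P : prect R n) : Prop :=
  exists (N : nat) (S : 'I_N -> prect R n),
    [/\ forall k, dyadic p d P (S k),
        trivIset setT (fun k => prect_set p (S k)),
        forall k, E_free E (prect_set p (S k)),
        forall k, (b <= lebesgue_xt (prect_set p (S k)))%E &
        (c%:E * lebesgue_xt (prect_set p P)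
           <= \sum_(k < N) lebesgue_xt (prect_set p (S k)))%E].

Definition weakly_porous (R : realType) (n : nat) (p : R) (d : nat)
    (c delta theta : R) (E : set ('rV[R]_n * R)) : Prop :=
  [/\ E !=set0, closed E &
    forall P : prect R n, prect_valid P ->
      free_family p d E c
        (delta%:E * lebesgue_xt (largest_free p d E (pshift p theta P)))%E P].

Lemma prect_set_child (R : realType) (n : nat) (p : R) (d : nat)
    (P : prect R n) (m : 'I_n -> 'I_(2 ^ d)) (j : nat) :
  0 < pside P ->
  let k : R := (nb_t p d (pgam P))%:R in
  let h := pside P / 2 ^+ d in
  let a i := pcenter P 0 i - pside P / 2 in
  let b := ptop P - pside P `^ p in
  prect_set p (child p P m j) =
  [set z : 'rV[R]_n * R |
     (forall i, a i + (m i)%:R * h <= z.1 0 i < a i + ((m i)%:R + 1) * h) /\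
     b + j%:R * (l_t p P / k) <= z.2 < b + (j%:R + 1) * (l_t p P / k)].
Proof.
move=> P0 k h a b.
have h0 : h `^ p != 0 by rewrite gt_eqF// powR_gt0// divr_gt0// exprn_gt0.
have xl i : pcenter (child p P m j) 0 i - h / 2 = a i + (m i)%:R * h.
  by rewrite /= mxE -/h -/(a i) mulrDl; field.
have xr i : pcenter (child p P m j) 0 i + h / 2 = a i + ((m i)%:R + 1) * h.
  by rewrite /= mxE -/h -/(a i) mulrDl; field.
have tl : ptop (child p P m j) - h `^ p = b + j%:R * (l_t p P / k).
  by rewrite /= -/h addrK.
have tr : ptop (child p P m j) - pgam (child p P m j) * h `^ p =
    b + (j%:R + 1) * (l_t p P / k).
  rewrite /= -/h -/k -/b mulrBl mul1r divfK//; ring.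
rewrite /prect_set tl tr; apply/seteqP; split=> z [zx zt]; split=> // i.
- by rewrite -xl -xr; exact: zx.
- by have := zx i; rewrite -xl -xr.
Qed.

Lemma lebesgue_itvco (R : realType) (a b : R) : a <= b ->
  lebesgue_measure [set x | a <= x < b] = (b - a)%:E.
Proof.
move=> ab.
have -> : [set x | a <= x < b] = [set` `[a, b[%R].
  by apply/seteqP; split=> x /=; rewrite in_itv.
rewrite lebesgue_measure_itv /= lte_fin; case: ltgtP ab => // -> _.
by rewrite subrr.
Qed.

Lemma measurable_setco (R : realType) (a b : R) :
  measurable [set x : R | a <= x < b].
Proof.
have -> : [set x | a <= x < b] = [set` `[a, b[%R].
  by apply/seteqP; split=> x /=; rewrite in_itv.
exact: measurable_itv.
Qed.

Lemma integral_scale_itvco (R : realType) (a b v : R) (f : R -> \bar R) :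
  a <= b -> (forall x, a <= x < b -> f x = v%:E) ->
  (forall x, ~~ (a <= x < b) -> f x = 0%E) ->
  (\int[lebesgue_measure]_(x in setT) f x = (v * (b - a))%:E)%E.
Proof.
move=> ab f1 f0.
rewrite [X in integral _ _ X](_ : _ = (fun=> v%:E) \_ [set x | a <= x < b]).
  rewrite -integral_mkcond.
  have := integral_cst (lebesgue_measure : {measure set _ -> \bar R})
    (measurable_setco a b) v%:E.
  by rewrite /cst => ->; rewrite [X in (_ * X)%E]lebesgue_itvco.
apply/funext=> x; rewrite patchE; case: ifPn; first by rewrite inE => /f1.
by rewrite notin_setE /= => /negP/f0.
Qed.

Lemma lebesgue_rV_set0 (R : realType) (n : nat) :
  lebesgue_rV (set0 : set 'rV[R]_n) = 0%E.
Proof.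
elim: n => [|n IHn] /=; first by rewrite indic0.
by rewrite -[RHS](integral0 lebesgue_measure setT); apply: eq_integral.
Qed.

Lemma lebesgue_rV_cube (R : realType) (n : nat) (a : 'rV[R]_n) (h : R) :
  0 <= h -> lebesgue_rV [set x | forall i, a 0 i <= x 0 i < a 0 i + h]
            = (h ^+ n)%:E.
Proof.
move=> h0; elim: n a => [|n IHn] a.
  rewrite /= indicE mem_set//; by case.
rewrite exprSr.
pose a' : 'rV[R]_n := \row_i a 0 (rshift 1 i).
have row0 (x : R) (v : 'rV[R]_n) : row_mx (x%:M : 'rV[R]_1) v 0 ord0 = x.
  have := row_mxEl (x%:M : 'rV[R]_1) v 0 ord0; rewrite [RHS]mxE eqxx mulr1n => {2}<-.
  by congr (fun_of_matrix _ _ _); exact/val_inj.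
have -> : h ^+ n * h = h ^+ n * ((a 0 ord0 + h) - a 0 ord0).
  by congr (_ * _); ring.
have rowS (x : R) (v : 'rV[R]_n) (i : 'I_n) :
    (row_mx (x%:M : 'rV[R]_1) v : 'rV[R]_n.+1) 0 (rshift 1 i) = v 0 i.
  exact: row_mxEr.
rewrite /=; apply: integral_scale_itvco; first by rewrite lerDl.
- move=> x xa; rewrite -(IHn a'); congr lebesgue_rV; apply/seteqP; split=> v /=.
    by move=> /[swap] i /(_ (rshift 1 i)); rewrite rowS mxE.
  move=> va i; case: (@split_ordP 1 n i) => j ij.
    have -> : i = ord0 by apply/val_inj; rewrite ij /= ord1.
    by rewrite row0.
  rewrite ij.
  by have := va j; rewrite rowS mxE.
- move=> x xa; rewrite -[RHS](lebesgue_rV_set0 R n); congr lebesgue_rV.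
  apply/seteqP; split=> v //= /(_ ord0); rewrite row0 => va.
  by rewrite va in xa.
Qed.

Lemma lebesgue_xt_prect (R : realType) (n : nat) (p : R) (P : prect R n) :
  0 < pside P -> pgam P <= 1 ->
  lebesgue_xt (prect_set p P) = (l_x P ^+ n * l_t p P)%:E.
Proof.
move=> P0 g1; have Lp : 0 <= pside P `^ p by exact: powR_ge0.
have -> : l_t p P = (ptop P - pgam P * pside P `^ p) - (ptop P - pside P `^ p).
  by rewrite /l_t; ring.
apply: integral_scale_itvco.
- by rewrite lerB// ler_piMl.
- move=> t tP; pose a : 'rV[R]_n := \row_i (pcenter P 0 i - pside P / 2).
  rewrite -(lebesgue_rV_cube a (ltW P0)); congr lebesgue_rV.
  have aE i : pcenter P 0 i + pside P / 2 = a 0 i + pside P.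
    by rewrite mxE; field.
  apply/seteqP; split=> x /=.
    by move=> [xP _] i; have := xP i; rewrite aE mxE.
  by move=> xP; split=> // i; have := xP i; rewrite -aE mxE.
- move=> t tP; rewrite -[RHS](lebesgue_rV_set0 R n); congr lebesgue_rV.
  by apply/seteqP; split=> x //= [_ tP']; rewrite tP' in tP.
Qed.

Lemma dyadic1_valid (R : realType) (n : nat) (p : R) (d : nat)
    (P Q : prect R n) :
  ln 9 / ln 2 <= d%:R * p -> prect_valid P -> dyadic1 p d P Q -> prect_valid Q.
Proof.
move=> dp [L0 /andP[g0 g1]] [m [j ->]]; split; first by rewrite /= divr_gt0.
set a : R := 2 `^ (d%:R * p).
have a9 : 9 <= a.
  have ln2 : 0 < ln (2 : R) by rewrite ln_gt0// ltr1n.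
  rewrite -ler_ln ?posrE ?powR_gt0//.
  by rewrite ln_powR -ler_pdivrMr.
have -> : pgam (child p P m j) =
    1 - (1 - pgam P) * a / (nb_t p d (pgam P))%:R.
  rewrite /= /l_t powRM ?invr_ge0 ?exprn_ge0 ?ltW//.
  have -> : ((2 ^+ d)^-1 : R) `^ p = a^-1.
    by rewrite -powR_inv1// -powR_mulrn// -!powRrM mulN1r mulrN powRN.
  have Lp : pside P `^ p != 0 by rewrite gt_eqF// powR_gt0.
  have a0 : a != 0 by lra.
  rewrite invfM invrK; set k := _%:R^-1; congr (_ - _).
  rewrite [RHS]mulrAC -!mulrA; congr (_ * _); rewrite mulrCA; congr (_ * _).
  by rewrite mulrA divff// mul1r.
rewrite /nb_t -/a (_ : 2 `^ (d%:R * p + 1) = 2 * a); last first.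
  by rewrite powRD ?pnatr_eq0 ?implybT// powRr1// mulrC.
set b := (X in if X then _ else _).
have : exists k : R, [/\ (if b then `|Num.ceil a|%N else `|Num.floor a|%N)%:R = k,
    b -> a <= k < a + 1 & ~~ b -> a - 1 < k <= a].
  case: (b); eexists; split=> // _.
    rewrite natr_absz ger0_norm; last by rewrite ceil_ge0; lra.
    by have := ceil_itv a; rewrite intrB; lra.
  rewrite natr_absz ger0_norm; last by rewrite floor_ge0; lra.
  by have := floor_itv a; rewrite intrD; lra.
move=> [k [-> kc kf]].
have a0 : 0 < a by lra.
set y := 1 - pgam P.
have bE : b = (a + 1 <= 2 * (y * a)).
  by rewrite /b lerBrDr addrC -lerBrDr ler_pdivrMr ?mulr_gt0// /y mulrCA.
have ya1 : y * a <= a by rewrite ler_piMl// /y; lra.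
have ya2 : a <= 2 * (y * a) by rewrite mulrA ler_peMl// /y; lra.
have [k0 yk ky] : [/\ 0 < k, y * a <= k & k <= 2 * (y * a)].
  case: (boolP b) => bb; first by have := kc bb; rewrite bE in bb; split; lra.
  by have := kf bb; rewrite bE -ltNge in bb; split; lra.
have q1 : y * a / k <= 1 by rewrite ler_pdivrMr// mul1r.
have q2 : 1 / 2 <= y * a / k by rewrite ler_pdivlMr//; lra.
lra.
Qed.

(* Main.v *)
Require Import Defs.
From mathcomp Require Import all_boot all_order all_algebra.
From mathcomp Require Import all_classical all_reals all_analysis.
From mathcomp Require Import ring lra.
Import Order.TTheory GRing.Theory Num.Theory.
Import numFieldNormedType.Exports.
Local Open Scope classical_set_scope.
Local Open Scope ring_scope.

Set Implicit Arguments.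
Unset Strict Implicit.
Unset Printing Implicit Defensive.

(** Call pore of scale [l] an [E]-free box of side [l] and height [l^p / 2].
    If [R^theta] contains a pore of scale [l], then, since a fine enough dyadic
    cell fits in it, weak porosity fills a fraction [c] of [R] with free
    rectangles of side at least a constant times [l].  These rectangles cannot
    all avoid a box occupying more than [1 - c] of [R], so one of them meets
    every rectangle of side [s] obtained from [R] by a small enough translation,
    of size [eps s] in space and [eps s^p] in time.  Hence pores propagate: a
    step of length [eps s] in any spatial direction costs a fixed factor in the
    scale and about [theta s^p] in time.  As [p > 1], for [s] a small fraction of
    the side [L] of [R] the [L / (eps s)] steps needed to cross [R] take only a
    small part of the time gap (psi - 1) l_t(R) between [R] and [R^psi], and the
    remaining time can be used up by further steps.  So the largest free
    rectangle of [R^psi] is transported, with a constant loss, into [Q^theta] for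
    every small dyadic [Q] in [R], and weak porosity at [Q] finishes the proof. *)

(** * Nonnegative weighted sums of volumes of boxes *)

Lemma itvco_weights_ge0 (R : realType) (T : finType) (w a b : T -> R) :
  (forall k, a k <= b k) ->
  (forall x, 0 <= \sum_k w k * (a k <= x < b k)%R%:R) ->
  0 <= \sum_k w k * (b k - a k).
Proof.
move=> ab pos.
pose mu : {measure set _ -> \bar R} := (@lebesgue_measure R).
pose A k := [set x : R | a k <= x < b k].
have AE k x : (a k <= x < b k)%R%:R = \1_(A k) x :> R.
  by rewrite indicE /A; congr (nat_of_bool _)%:R; apply/idP/idP; rewrite inE.
have muA k : mu (A k) = (b k - a k)%:E by exact: lebesgue_itvco.
have mA k : measurable (A k) by exact: measurable_setco.
have iA k : mu.-integrable setT (EFin \o \1_(A k)).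
  rewrite (_ : A k = [set` `[a k, b k[]); first exact: integrable_indic_itv.
  by apply/seteqP; split=> x /=; rewrite in_itv.
pose f k x : \bar R := ((w k)%:E * (\1_(A k) x)%:E)%E.
have fint k : mu.-integrable setT (f k) by apply: integrableZl => //; exact: iA.
rewrite -lee_fin -sumEFin.
rewrite (_ : (\sum_k _)%E = (\int[mu]_x \sum_k f k x)%E); last first.
  rewrite integral_sum//; apply: eq_bigr => k _.
  rewrite /f integralZl//; last exact: iA.
  rewrite (integral_indic mu measurableT (mA k)) setIT muA.
  by rewrite EFinM.
apply: integral_ge0 => x _.
rewrite /f (eq_bigr (fun k => (w k * \1_(A k) x)%:E)); last by move=> *; rewrite EFinM.
rewrite sumEFin lee_fin (le_trans (pos x))// le_eqVlt; apply/orP; left.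
by apply/eqP/eq_bigr => k _; rewrite AE.
Qed.

(** Induction on the dimension: for a fixed last coordinate its indicator joins the weights, and the
    one-dimensional case then integrates it out. Weights of either sign make packing bounds a
    special case. *)
Lemma box_weights_ge0 (R : realType) (T : finType) (m : nat) (w : T -> R)
    (a b : T -> nat -> R) :
  (forall k i, a k i <= b k i) ->
  (forall x : nat -> R,
     0 <= \sum_k w k * \prod_(i < m) (a k i <= x i < b k i)%R%:R) ->
  0 <= \sum_k w k * \prod_(i < m) (b k i - a k i).
Proof.
move=> ab; elim: m w => [|m IHm] w pos.
  apply: le_trans (pos (fun=> 0)) _.
  by rewrite le_eqVlt; apply/orP; left; apply/eqP/eq_bigr => k _; rewrite !big_ord0.
under eq_bigr => k _ do rewrite big_ord_recr /= mulrA.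
apply: itvco_weights_ge0 => // t.
under eq_bigr => k _ do rewrite mulrAC.
apply: IHm => x.
apply: le_trans (pos (fun i => if i == m then t else x i)) _.
rewrite le_eqVlt; apply/orP; left; apply/eqP/eq_bigr => k _.
rewrite big_ord_recr /= eqxx mulrA mulrAC; congr (_ * _ * _).
by apply: eq_bigr => i _; rewrite ltn_eqF.
Qed.

Definition box (R : realType) (n : nat) (a : 'rV[R]_n) (l u h : R) :
    set ('rV[R]_n * R) :=
  [set z : 'rV[R]_n * R | (forall i, a 0 i <= z.1 0 i < a 0 i + l) /\
     u <= z.2 < u + h].

Lemma box_indic_weights_ge0 (R : realType) (n : nat) (T : finType) (w : T -> R)
    (a : T -> 'rV[R]_n) (l u h : T -> R) :
  (forall k, 0 <= l k) -> (forall k, 0 <= h k) ->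
  (forall z, 0 <= \sum_k w k * (\1_(box (a k) (l k) (u k) (h k)) z : R)) ->
  0 <= \sum_k w k * (l k ^+ n * h k).
Proof.
move=> l0 h0 pos.
(* Indices below [n] are spatial; index [n], where [insub] fails, is time. *)
pose lo k i : R := if insub i is Some j then a k 0 j else u k.
pose hi k i : R := if insub i is Some j then a k 0 j + l k else u k + h k.
have loE k (i : 'I_n) : lo k i = a k 0 i by rewrite /lo valK.
have hiE k (i : 'I_n) : hi k i = a k 0 i + l k by rewrite /hi valK.
have loN k : lo k n = u k by rewrite /lo insubF// ltnn.
have hiN k : hi k n = u k + h k by rewrite /hi insubF// ltnn.
have := @box_weights_ge0 R T n.+1 w lo hi; set X := (X in _ -> _ -> 0 <= X).
rewrite (_ : X = \sum_k w k * (l k ^+ n * h k)); last first.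
  apply: eq_bigr => k _; rewrite big_ord_recr /= loN hiN addrAC subrr add0r.
  congr (_ * (_ * _)); rewrite (eq_bigr (fun=> l k)).
    by rewrite prodr_const card_ord.
  by move=> i _; rewrite loE hiE addrAC subrr add0r.
apply=> [k i|x].
  by rewrite /lo /hi; case: insubP => [j _ _|_]; rewrite lerDl.
apply: le_trans (pos (\row_i x i, x n)) _.
rewrite le_eqVlt; apply/orP; left; apply/eqP/eq_bigr => k _; congr (_ * _).
rewrite big_ord_recr /= loN hiN.
rewrite (eq_bigr (fun i : 'I_n => (a k 0 i <= x i < a k 0 i + l k)%R%:R)); last first.
  by move=> i _; rewrite loE hiE.
rewrite -natr_prod -natrM indicE; congr (_%:R).
rewrite (_ : (\prod_(i < n) _)%N = [forall i, a k 0 i <= x i < a k 0 i + l k]); last first.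
  case: forallP => [ax|/forallP]; first by rewrite big1// => i _; rewrite ax.
  rewrite negb_forall => /existsP[i /negbTE ai].
  by apply/eqP; rewrite -leqn0 (bigD1 i)//= ai mul0n.
rewrite mulnb; congr nat_of_bool; apply/idP/idP.
  rewrite inE => -[/= xa xu]; apply/andP; split=> //; apply/forallP => i.
  by have := xa i; rewrite mxE.
move=> /andP[/forallP xa xu]; rewrite inE; split=> //= i.
by have := xa i; rewrite mxE.
Qed.

(** * Parabolic rectangles as boxes, and bounds on their volume *)

Lemma powR_le_base (R : realType) (p x : R) : 1 <= p -> 0 <= x <= 1 -> x `^ p <= x.
Proof.
move=> p1 /andP[]; rewrite le_eqVlt => /orP[/eqP<- _|x0 x1].
  by rewrite powR0// gt_eqF//; lra.
by apply: ge1r_powR => //; rewrite x0.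
Qed.

Lemma lx_gt0 (R : realType) (n : nat) (P : prect R n) :
  prect_valid P -> 0 < l_x P.
Proof. by case. Qed.

Lemma l_t_bounds (R : realType) (n : nat) (p : R) (P : prect R n) :
  prect_valid P -> [/\ 0 < l_t p P, l_x P `^ p / 2 <= l_t p P & l_t p P <= l_x P `^ p].
Proof.
rewrite /l_t /l_x => -[L0 /andP[g0 g1]].
have Lp : 0 < pside P `^ p by rewrite powR_gt0.
by split; nra.
Qed.

Definition pcorner (R : realType) (n : nat) (P : prect R n) : 'rV[R]_n :=
  \row_i (pcenter P 0 i - pside P / 2).

Definition pbot (R : realType) (n : nat) (p : R) (P : prect R n) : R :=
  ptop P - pside P `^ p.

Lemma prect_set_box (R : realType) (n : nat) (p : R) (P : prect R n) :
  prect_set p P = box (pcorner P) (l_x P) (pbot p P) (l_t p P).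
Proof.
rewrite /prect_set /box /pbot /l_x.
have -> : ptop P - pside P `^ p + l_t p P = ptop P - pgam P * pside P `^ p.
  by rewrite /l_t; ring.
have e i : pcorner P 0 i + pside P = pcenter P 0 i + pside P / 2.
  by rewrite mxE; field.
by apply/seteqP; split=> z [zx zt]; split=> // i; have := zx i; rewrite e mxE.
Qed.

Definition vol (R : realType) (n : nat) (p : R) (P : prect R n) : R :=
  l_x P ^+ n * l_t p P.

Lemma lebesgue_xt_vol (R : realType) (n : nat) (p : R) (P : prect R n) :
  prect_valid P -> lebesgue_xt (prect_set p P) = (vol p P)%:E.
Proof. by move=> [L0 /andP[g0 g1]]; rewrite lebesgue_xt_prect//; lra. Qed.

Lemma vol_bounds (R : realType) (n : nat) (p : R) (P : prect R n) :
  prect_valid P ->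
  l_x P ^+ n * l_x P `^ p / 2 <= vol p P <= l_x P ^+ n * l_x P `^ p.
Proof.
move=> vP; have [_ h1 h2] := l_t_bounds p vP.
have Ln : 0 <= l_x P ^+ n by rewrite exprn_ge0// ltW//; case: vP.
by rewrite -mulrA !ler_wpM2l.
Qed.

Lemma vol_gt0 (R : realType) (n : nat) (p : R) (P : prect R n) :
  prect_valid P -> 0 < vol p P.
Proof.
move=> vP; have [h _ _] := l_t_bounds p vP.
by rewrite mulr_gt0// exprn_gt0//; case: vP.
Qed.

Lemma nb_t_gt0 (R : realType) (p : R) (d : nat) (g : R) :
  ln 9 / ln 2 <= d%:R * p -> (0 < nb_t p d g)%N.
Proof.
move=> dp; rewrite /nb_t; set a : R := 2 `^ (d%:R * p).
have a9 : 9 <= a.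
  have ln2 : 0 < ln (2 : R) by rewrite ln_gt0// ltr1n.
  rewrite -ler_ln ?posrE ?powR_gt0//.
  by rewrite ln_powR -ler_pdivrMr.
case: ifP => _; rewrite absz_gt0 gt_eqF//.
  by rewrite -(ltr_int R) (lt_le_trans _ (ceil_ge a))//; lra.
by rewrite -(ltr_int R); have := floor_itv a; rewrite intrD; lra.
Qed.

(** * The dyadic lattice *)

Section Dyadic.
Variables (R : realType) (n : nat) (p : R) (d : nat).
Hypothesis dp : ln 9 / ln 2 <= d%:R * p.
Implicit Types P Q : prect R n.

Lemma child_lx P (m : 'I_n -> 'I_(2 ^ d)) j : l_x (child p P m j) = l_x P / 2 ^+ d.
Proof. by []. Qed.

Lemma child_lt P (m : 'I_n -> 'I_(2 ^ d)) j : 0 < l_x P ->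
  l_t p (child p P m j) = l_t p P / (nb_t p d (pgam P))%:R.
Proof.
move=> L0; rewrite /l_t /= opprB addrCA subrr addr0 divfK//.
by rewrite gt_eqF// powR_gt0// divr_gt0// exprn_gt0.
Qed.

Lemma child_bot P (m : 'I_n -> 'I_(2 ^ d)) j : 0 < l_x P ->
  pbot p (child p P m j) = pbot p P + j%:R * l_t p (child p P m j).
Proof. by move=> L0; rewrite child_lt// /pbot /= addrK. Qed.

Lemma child_corner P (m : 'I_n -> 'I_(2 ^ d)) j i :
  pcorner (child p P m j) 0 i = pcorner P 0 i + (m i)%:R * l_x (child p P m j).
Proof. by rewrite !mxE /l_x /=; field; rewrite expf_neq0. Qed.

Lemma child_sub P (m : 'I_n -> 'I_(2 ^ d)) (j : 'I_(nb_t p d (pgam P))) :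
  prect_valid P -> prect_set p (child p P m j) `<=` prect_set p P.
Proof.
move=> vP; have L0 := lx_gt0 vP; have [lt0 _ _] := l_t_bounds p vP.
have k0 : 0 < (nb_t p d (pgam P))%:R :> R by rewrite ltr0n nb_t_gt0.
rewrite !prect_set_box => z [zx]; rewrite child_bot// child_lt//.
set h := _ / _ => zt.
have h0 : 0 < h by rewrite divr_gt0.
have le (k N : nat) (y : R) : 0 < y -> (k < N)%N -> (k%:R + 1) * y <= N%:R * y.
  by move=> y0 kN; rewrite ler_pM2r// natr1 ler_nat.
split=> [i|].
  have := zx i; rewrite child_corner child_lx.
  set g := _ / _ => zi.
  have g0 : 0 < g by rewrite divr_gt0// exprn_gt0.
  have gE : (2 ^ d)%:R * g = l_x P by rewrite natrX mulrC divfK// expf_neq0.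
  have := le _ _ _ g0 (ltn_ord (m i)); rewrite gE mulrDl mul1r.
  have : 0 <= (m i)%:R * g by rewrite mulr_ge0// ltW.
  lra.
have hE : (nb_t p d (pgam P))%:R * h = l_t p P by rewrite mulrC divfK// gt_eqF.
have := le _ _ _ h0 (ltn_ord j); rewrite hE mulrDl mul1r.
have : 0 <= j%:R * h by rewrite mulr_ge0// ltW.
lra.
Qed.

Lemma exists_cell (N : nat) (a y h : R) : 0 < h -> a <= y < a + N%:R * h ->
  exists j : 'I_N, a + j%:R * h <= y < a + j%:R * h + h.
Proof.
move=> h0 /andP[ay yN].
have q0 : 0 <= (y - a) / h by rewrite divr_ge0 ?subr_ge0 ?(ltW h0).
have /andP[t1 t2] := truncn_itv q0.
have tN : (Num.truncn ((y - a) / h) < N)%N.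
  by rewrite -(ltr_nat R) (le_lt_trans t1)// ltr_pdivrMr// ltrBlDl.
exists (Ordinal tN) => /=; move: t1 t2; rewrite ler_pdivlMr// ltr_pdivrMr//.
by set q := Num.truncn _; rewrite -natr1 mulrDl mul1r; lra.
Qed.

Lemma dyadic1_cover P z : prect_valid P -> prect_set p P z ->
  exists2 Q, dyadic1 p d P Q & prect_set p Q z.
Proof.
move=> vP; have L0 := lx_gt0 vP; have [lt0 _ _] := l_t_bounds p vP.
have k0 : 0 < (nb_t p d (pgam P))%:R :> R by rewrite ltr0n nb_t_gt0.
rewrite prect_set_box => -[zx zt].
have g0 : 0 < l_x P / 2 ^+ d by rewrite divr_gt0// exprn_gt0.
have gE : (2 ^ d)%:R * (l_x P / 2 ^+ d) = l_x P.
  by rewrite natrX mulrC divfK// expf_neq0.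
have h0 : 0 < l_t p P / (nb_t p d (pgam P))%:R by rewrite divr_gt0.
have /choice[m mP] : forall i, exists j : 'I_(2 ^ d),
    pcorner P 0 i + j%:R * (l_x P / 2 ^+ d) <= z.1 0 i
      < pcorner P 0 i + j%:R * (l_x P / 2 ^+ d) + l_x P / 2 ^+ d.
  by move=> i; apply: exists_cell => //; rewrite gE.
have [j jP] : exists j : 'I_(nb_t p d (pgam P)),
    pbot p P + j%:R * (l_t p P / (nb_t p d (pgam P))%:R) <= z.2
      < pbot p P + j%:R * (l_t p P / (nb_t p d (pgam P))%:R)
        + l_t p P / (nb_t p d (pgam P))%:R.
  apply: exists_cell => //; rewrite mulrC divfK// gt_eqF//.
exists (child p P m j); first by exists m, j.
rewrite prect_set_box; split=> [i|]; first by rewrite child_corner.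
by rewrite child_bot// child_lt.
Qed.

Lemma cell_inj (j k : nat) (a y h : R) : 0 < h ->
  a + j%:R * h <= y < a + j%:R * h + h -> a + k%:R * h <= y < a + k%:R * h + h ->
  j = k.
Proof.
move=> h0 jy ky.
have jk (i l : nat) : i%:R * h < l%:R * h + h -> (i <= l)%N.
  by rewrite -[X in _ + X]mul1r -mulrDl ltr_pM2r// natr1 ltr_nat.
by apply/eqP; rewrite eqn_leq !jk//; lra.
Qed.

Lemma child_disjoint P (m m' : 'I_n -> 'I_(2 ^ d)) (j j' : nat) z :
  prect_valid P ->
  prect_set p (child p P m j) z -> prect_set p (child p P m' j') z ->
  m = m' /\ j = j'.
Proof.
move=> vP; have L0 := lx_gt0 vP; have [lt0 _ _] := l_t_bounds p vP.
have k0 : 0 < (nb_t p d (pgam P))%:R :> R by rewrite ltr0n nb_t_gt0.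
have g0 : 0 < l_x P / 2 ^+ d by rewrite divr_gt0// exprn_gt0.
have h0 : 0 < l_t p P / (nb_t p d (pgam P))%:R by rewrite divr_gt0.
rewrite !prect_set_box => -[zx zt] [zx' zt']; split.
  apply/funext => i; apply/val_inj; have := zx' i; have := zx i.
  by rewrite !child_corner; apply: cell_inj.
by move: zt zt'; rewrite !child_bot// !child_lt//; apply: cell_inj.
Qed.

Lemma dyadic_gen_valid i P Q :
  prect_valid P -> dyadic_gen p d i P Q -> prect_valid Q.
Proof.
move=> vP; elim: i Q => [Q ->//|i IHi Q [Q' /IHi vQ' QQ']].
exact: dyadic1_valid QQ'.
Qed.

Lemma dyadic_valid P Q : prect_valid P -> dyadic p d P Q -> prect_valid Q.
Proof. by move=> vP [i _]; exact: dyadic_gen_valid. Qed.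

Lemma dyadic_gen_sub i P Q :
  prect_valid P -> dyadic_gen p d i P Q -> prect_set p Q `<=` prect_set p P.
Proof.
move=> vP; elim: i Q => [Q ->//|i IHi Q [Q' Q'P [m [j ->]]]].
apply: subset_trans (IHi _ Q'P); apply: child_sub; exact: dyadic_gen_valid Q'P.
Qed.

Lemma dyadic_sub P Q :
  prect_valid P -> dyadic p d P Q -> prect_set p Q `<=` prect_set p P.
Proof. by move=> vP [i _]; exact: dyadic_gen_sub. Qed.

Lemma dyadic_gen_lx i P Q :
  dyadic_gen p d i P Q -> l_x Q = l_x P / 2 ^+ (d * i).
Proof.
elim: i Q => [Q ->|i IHi Q [Q' /IHi Q'P [m [j ->]]]]; first by rewrite muln0 divr1.
by rewrite child_lx Q'P mulnS addnC exprD invfM mulrA.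
Qed.

(** The truncation of a child depends only on the side and truncation of its parent, so it is
    constant throughout a generation. With [dyadic_gen_lx], cells of one generation are translates
    of each other. *)
Lemma dyadic_gen_pgam i P Q Q' :
  dyadic_gen p d i P Q -> dyadic_gen p d i P Q' -> pgam Q = pgam Q'.
Proof.
elim: i Q Q' => [Q Q' -> ->//|i IHi Q Q' [S SP [m [j ->]]] [S' S'P [m' [j' ->]]]].
rewrite /= (IHi _ _ SP S'P).
have sE : l_x S = l_x S' by rewrite (dyadic_gen_lx SP) (dyadic_gen_lx S'P).
by rewrite /l_t -/(l_x S) -/(l_x S') sE (IHi _ _ SP S'P).
Qed.

Lemma dyadic_gen_cover i P z : prect_valid P -> prect_set p P z ->
  exists2 Q, dyadic_gen p d i P Q & prect_set p Q z.
Proof.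
move=> vP zP; elim: i => [|i [Q QP zQ]]; first by exists P.
have [S SQ zS] := dyadic1_cover (dyadic_gen_valid vP QP) zQ.
by exists S => //; exists Q.
Qed.

Lemma dyadic_gen_child i P Q S :
  dyadic1 p d P Q -> dyadic_gen p d i Q S -> dyadic_gen p d i.+1 P S.
Proof.
move=> QP; elim: i S => [S ->|i IHi S [S' /IHi S'P SS']]; first by exists P.
by exists S'.
Qed.

Lemma dyadic_child P Q S : dyadic1 p d P Q -> dyadic p d Q S -> dyadic p d P S.
Proof. by move=> QP [i _ SQ]; exists i.+1 => //; exact: dyadic_gen_child SQ. Qed.

End Dyadic.

(** The lower corner gives the lower bounds. An upper face sticking out would leave a point of the
    inner box with a coordinate on or beyond the upper face of the outer one. *)
Lemma box_subset_coord (R : realType) (n : nat) (a a' : 'rV[R]_n)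
    (l l' u u' h h' : R) :
  0 < l -> 0 < h -> box a l u h `<=` box a' l' u' h' ->
  (forall i, a' 0 i <= a 0 i /\ a 0 i + l <= a' 0 i + l') /\
  (u' <= u /\ u + h <= u' + h').
Proof.
move=> l0 h0 sub.
have corner t : u <= t < u + h -> box a l u h (a, t).
  by move=> ut; split=> //= i; lra.
have [cx ct] : box a' l' u' h' (a, u) by apply: sub; apply: corner; lra.
split=> [i|].
  split; first by case/andP: (cx i).
  rewrite leNgt; apply/negP => lt.
  pose m := Num.max (a 0 i) (a' 0 i + l').
  pose z : 'rV[R]_n := \row_j if j == i then m else a 0 j.
  have : box a l u h (z, u).
    split=> [j|] /=; last by lra.
    rewrite mxE; case: eqP => [->|_]; last by lra.
    by rewrite /m le_max lexx /= gt_max lt andbT; lra.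
  move=> /sub[/(_ i)] /=; rewrite mxE eqxx => /andP[_ +] _.
  by rewrite /m gt_max ltxx andbF.
split; first by case/andP: ct.
rewrite leNgt; apply/negP => lt.
pose m := Num.max u (u' + h').
have : box a l u h (a, m).
  by apply: corner; rewrite /m le_max lexx /= gt_max lt andbT; lra.
by move=> /sub[_] /= /andP[_]; rewrite /m gt_max ltxx andbF.
Qed.

(** * Weak porosity in terms of side lengths *)

Section Porous.
Variables (R : realType) (n : nat) (p : R) (d : nat).
Hypotheses (n1 : (1 <= n)%N) (p1 : 1 < p) (d1 : (1 <= d)%N).
Hypothesis dp : ln 9 / ln 2 <= d%:R * p.
Implicit Types (E : set ('rV[R]_n * R)) (P Q S : prect R n).

Let p0 : 0 < p := lt_trans ltr01 p1.

Lemma prect_set_subset_lx P Q : prect_valid P ->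
  prect_set p P `<=` prect_set p Q -> l_x P <= l_x Q.
Proof.
move=> vP; have L0 := lx_gt0 vP; have [lt0 _ _] := l_t_bounds p vP.
rewrite !prect_set_box => /(box_subset_coord L0 lt0)[/(_ (Ordinal n1)) + _].
by move=> [? ?]; lra.
Qed.

Lemma gen_lx_le i j (L : R) : 0 < L ->
  (L / 2 ^+ (d * i) <= L / 2 ^+ (d * j)) = (j <= i)%N.
Proof.
move=> L0; rewrite ler_pM2l// lef_pV2 ?posrE ?exprn_gt0//.
by rewrite ler_eXn2l ?leq_pmul2l ?ltr1n.
Qed.

(** This bounds the side of M(P) from below, whichever member [xget] selects. *)
Lemma largest_free_ge E P Q : prect_valid P -> dyadic p d P Q ->
  E_free E (prect_set p Q) ->
  exists M, [/\ max_free p d E P M, largest_free p d E P = prect_set p M &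
    l_x Q <= l_x M].
Proof.
move=> vP [iQ _ QP] Qfree; have L0 := lx_gt0 vP.
pose freegen i := `[< exists2 S, dyadic_gen p d i P S & E_free E (prect_set p S) >].
have ex : exists i, freegen i by exists iQ; apply/asboolP; exists Q.
(* A free cell of least generation is maximal and has the largest side. *)
have [i /asboolP[S SP Sfree] imin] := ex_minnP ex.
have big S' : dyadic p d P S' -> E_free E (prect_set p S') -> l_x S' <= l_x S.
  move=> [j _ S'P] S'free; rewrite (dyadic_gen_lx SP) (dyadic_gen_lx S'P).
  by rewrite gen_lx_le//; apply: imin; apply/asboolP; exists S'.
have Smax : max_free p d E P S.
  split=> //; first by exists i.
  (* A free cell containing [S] has the same side, hence the same generation, truncation and height;
     a box containing a box of equal dimensions equals it. *)
  move=> S' S'dP S'free SS'; have [j _ S'P] := S'dP.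
  have vS := dyadic_gen_valid dp vP SP.
  have vS' := dyadic_gen_valid dp vP S'P.
  have lE : l_x S' = l_x S.
    by apply/eqP; rewrite eq_le big//= prect_set_subset_lx.
  have ij : j = i.
    apply/eqP; rewrite eqn_leq -!(gen_lx_le _ _ L0).
    by rewrite -(dyadic_gen_lx SP) -(dyadic_gen_lx S'P) lE lexx.
  move: S'P; rewrite ij => /(dyadic_gen_pgam SP) gE.
  have S0 := lx_gt0 vS; have [lt0 _ _] := l_t_bounds p vS.
  have ltE : l_t p S' = l_t p S by rewrite /l_t -/(l_x S') -/(l_x S) lE gE.
  move: SS'; rewrite !prect_set_box lE ltE => /(box_subset_coord S0 lt0)[cx ct].
  have -> : pbot p S' = pbot p S by lra.
  by congr box; apply/rowP => k; have := cx k; lra.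
have [M [Mmax Mbig ->]] : exists M, [/\ max_free p d E P M,
    forall Q', max_free p d E P Q' -> l_x Q' <= l_x M &
    largest_free p d E P = prect_set p M].
  (* The default value of [xget] is excluded by the candidate [S]. *)
  rewrite /largest_free; case: xgetP => [A -> //|/(_ (prect_set p S))[]].
  by exists S; split=> // S' [S'P S'free _]; exact: big.
exists M; split=> //; apply: le_trans (Mbig _ Smax); apply: big => //.
by exists iQ.
Qed.

(** A real-valued form of [free_family]. Any finite index type is allowed, so that families glue
    over a sigma type, and any requirement [A] on the members, so that lower bounds on sides can be
    carried along. *)
Definition pore_family E (c : R) (A : prect R n -> Prop) P : Prop :=
  exists (T : finType) (S : T -> prect R n),
    [/\ forall k, dyadic p d P (S k),
        forall k k' z, prect_set p (S k) z -> prect_set p (S k') z -> k = k',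
        forall k, E_free E (prect_set p (S k)),
        forall k, A (S k) &
        c * vol p P <= \sum_k vol p (S k)].

Lemma free_familyE E c b P : prect_valid P ->
  free_family p d E c b P <-> pore_family E c (fun S => b <= (vol p S)%:E)%E P.
Proof.
move=> vP; split.
  move=> [N [S [SP Sdisj Sfree Sb Sc]]].
  have volS k := lebesgue_xt_vol p (dyadic_valid dp vP (SP k)).
  exists 'I_N, S; split=> //.
  - by move=> k k' z zk zk'; apply: (Sdisj k k') => //; exists z.
  - by move=> k; rewrite -volS.
  - move: Sc; rewrite lebesgue_xt_vol// -EFinM (eq_bigr _ (fun k _ => volS k)).
    by rewrite sumEFin lee_fin.
move=> [T [S [SP Sdisj Sfree Sb Sc]]].
have volS k := lebesgue_xt_vol p (dyadic_valid dp vP (SP k)).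
exists #|T|, (fun k => S (enum_val k)); split=> //.
- by move=> k k' _ _ [z [zk zk']]; apply: enum_val_inj; exact: Sdisj zk zk'.
- by move=> k; rewrite volS.
- rewrite lebesgue_xt_vol// -EFinM (eq_bigr _ (fun k _ => volS _)) sumEFin lee_fin.
  apply: le_trans Sc _; rewrite le_eqVlt; apply/orP; left; apply/eqP.
  rewrite (reindex (@enum_val T predT))//=.
  by apply: onW_bij; apply: enum_val_bij.
Qed.

Lemma pore_family_mono E c (A B : prect R n -> Prop) P :
  (forall S, dyadic p d P S -> A S -> B S) ->
  pore_family E c A P -> pore_family E c B P.
Proof.
move=> AB [T [S [SP Sdisj Sfree SA Sc]]]; exists T, S; split=> // k.
exact: AB.
Qed.

(** The least generation with side at most [l / 4] works: the preceding one still exceeds [l / 4]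
    and is [2 ^+ d] times longer. *)
Lemma exists_gen (L l : R) : 0 < l <= L ->
  exists i, l / 4 / 2 ^+ d <= L / 2 ^+ (d * i) <= l / 4.
Proof.
move=> /andP[l0 lL].
have ex : exists i, L / 2 ^+ (d * i) <= l / 4.
  pose i := Num.truncn (4 * L / l); exists i.+1.
  have q0 : 0 <= 4 * L / l by rewrite divr_ge0//; lra.
  have /andP[_ +] := truncn_itv q0; rewrite -/i => iL.
  rewrite ler_pdivrMr ?exprn_gt0//.
  have : (i.+1)%:R <= 2 ^+ (d * i.+1) :> R.
    rewrite -natrX ler_nat (leq_trans (ltnW (ltn_expl i.+1 (isT : (1 < 2)%N))))//.
    by rewrite leq_exp2l// leq_pmull.
  move: iL; rewrite ltr_pdivrMr// => h1 h2.
  have : i.+1%:R * l <= 2 ^+ (d * i.+1) * l by rewrite ler_pM2r.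
  lra.
have [[|i] iP imin] := ex_minnP ex.
  (* Generation 0 is excluded because [l <= L]. *)
  by move: iP; rewrite muln0 divr1; lra.
exists i.+1; rewrite iP andbT leNgt; apply/negP => lt.
suff /imin : L / 2 ^+ (d * i) <= l / 4 by rewrite ltnn.
move: lt; rewrite mulnS addnC exprD invfM mulrA ltr_pM2r ?invr_gt0 ?exprn_gt0//.
exact: ltW.
Qed.

(** If [y < k * x], the right side is less than k to the power n + p times the value at [x], and
    this power is at most [k]. *)
Lemma vol_le_lx (k x y : R) : 0 < k <= 1 -> 0 < x -> 0 < y ->
  k * (x ^+ n * x `^ p) <= y ^+ n * y `^ p -> k * x <= y.
Proof.
move=> /andP[k0 k1] x0 y0; rewrite !leNgt; apply: contra => yx.
have kx0 : 0 < k * x by rewrite mulr_gt0.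
have V : y ^+ n * y `^ p < (k * x) ^+ n * (k * x) `^ p.
  apply: ltr_pM; rewrite ?exprn_ge0 ?powR_ge0 ?(ltW y0)//.
    by rewrite ltrXn2r ?gtn_eqF ?ltW.
  apply: gt0_ltr_powR => //; rewrite nnegrE; exact: ltW.
apply: (lt_le_trans V); rewrite exprMn powRM ?(ltW k0) ?(ltW x0)// mulrACA.
rewrite ler_pM2r ?mulr_gt0 ?exprn_gt0 ?powR_gt0//.
have kp : k `^ p <= k by apply: powR_le_base; [exact: ltW|lra].
apply: le_trans kp; by rewrite ler_piMl ?powR_ge0// exprn_ile1 ?(ltW k0).
Qed.

(** Take the cell of side at most [l / 4] through the centre of the box. As p > 1, its height is at
    most l^p / 4, so it does not reach beyond the faces. *)
Lemma box_contains_gen P (a : 'rV[R]_n) (l u : R) : prect_valid P ->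
  0 < l <= l_x P -> box a l u (l `^ p / 2) `<=` prect_set p P ->
  exists2 G, dyadic p d P G /\ prect_set p G `<=` box a l u (l `^ p / 2) &
    l / 4 / 2 ^+ d <= l_x G.
Proof.
move=> vP lL sub; have [i /andP[i1 i2]] := exists_gen lL.
have /andP[l0 _] := lL; have lp0 : 0 < l `^ p by rewrite powR_gt0.
pose z : 'rV[R]_n := \row_j (a 0 j + l / 2).
have [G GP zG] : exists2 G, dyadic_gen p d i P G & prect_set p G (z, u + l `^ p / 4).
  apply: dyadic_gen_cover => //; apply: sub; split=> /= [j|]; last by lra.
  by rewrite mxE; lra.
have vG := dyadic_gen_valid dp vP GP; have [lt0 _ ltG] := l_t_bounds p vG.
have Gx := dyadic_gen_lx GP; rewrite -Gx in i1 i2.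
exists G => //; split; first by exists i.
have G0 := lx_gt0 vG.
have hG : l_x G `^ p <= l `^ p / 4.
  have : l_x G `^ p <= (4^-1 * l) `^ p.
    by apply: ge0_ler_powR; rewrite ?nnegrE ?(ltW p0)//; lra.
  rewrite powRM ?(ltW l0)// => /le_trans; apply; rewrite mulrC ler_pM2l//.
  by apply: powR_le_base; [exact: ltW|lra].
move: zG; rewrite prect_set_box => -[zx zt] y [yx yt]; split=> [j|].
  have zj : z 0 j = a 0 j + l / 2 by rewrite mxE.
  by have := zx j; have := yx j; rewrite /= zj; lra.
by move: zt; rewrite /=; lra.
Qed.

(** The constant has two sources. A cell inside the pore has side at least [l / 4 / 2 ^+ d], and
    passing from volumes to sides turns [delta] into [delta / 2], since truncation may halve a
    volume. *)
Lemma porous_family E (c delta theta : R) P (a : 'rV[R]_n) (l u : R) :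
  0 < delta < 1 -> weakly_porous p d c delta theta E -> prect_valid P ->
  0 < l <= l_x P ->
  box a l u (l `^ p / 2) `<=` prect_set p (pshift p theta P) ->
  E_free E (box a l u (l `^ p / 2)) ->
  pore_family E c (fun S => delta / 8 / 2 ^+ d * l <= l_x S) P.
Proof.
move=> /andP[delta0 delta1] [_ _ wp] vP lL sub free.
have vP' : prect_valid (pshift p theta P) by [].
have [G [GP GB] lG] := box_contains_gen vP' lL sub.
have Gfree : E_free E (prect_set p G).
  by apply/seteqP; split=> // y [/GB yB yE]; rewrite -free; split.
have [M [[MP _ _] GM GM']] := largest_free_ge vP' GP Gfree.
have vM := dyadic_valid dp vP' MP.
move: (wp _ vP); rewrite GM lebesgue_xt_vol// => /(free_familyE _ _ _ vP).
apply: pore_family_mono => S SP; rewrite -EFinM lee_fin => dS.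
have vS := dyadic_valid dp vP SP.
have /andP[_ S2] := vol_bounds p vS; have /andP[M1 _] := vol_bounds p vM.
have dM : delta / 2 * l_x M <= l_x S.
  apply: vol_le_lx; [lra|exact: lx_gt0|exact: lx_gt0|].
  apply: le_trans S2; apply: le_trans dS; rewrite mulrAC -mulrA.
  by rewrite ler_pM2l// mulrC.
apply: le_trans dM.
have : delta / 2 * (l / 4 / 2 ^+ d) <= delta / 2 * l_x M.
  by rewrite ler_pM2l; [exact: le_trans lG GM'|lra].
by apply: le_trans; rewrite le_eqVlt; apply/orP; left; apply/eqP; field; rewrite expf_neq0.
Qed.

End Porous.

(** * Packing of boxes and one step of pore propagation *)

(** Give weight 1 to the enclosing box and -1 to the others. By disjointness at most one of the
    latter covers a given point, so the weighted sum of indicators is nonnegative. *)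
Lemma box_packing (R : realType) (n : nat) (T : finType) (a : T -> 'rV[R]_n)
    (l u h : T -> R) (b : 'rV[R]_n) (L v H : R) :
  (forall k, 0 <= l k) -> (forall k, 0 <= h k) -> 0 <= L -> 0 <= H ->
  (forall k k' z, box (a k) (l k) (u k) (h k) z ->
     box (a k') (l k') (u k') (h k') z -> k = k') ->
  (forall k, box (a k) (l k) (u k) (h k) `<=` box b L v H) ->
  \sum_k l k ^+ n * h k <= L ^+ n * H.
Proof.
move=> l0 h0 L0 H0 disj sub.
pose ext A (x : A) (f : T -> A) (k : 'I_1 + T) := if k is inr k' then f k' else x.
have := @box_indic_weights_ge0 R n ('I_1 + T)%type (ext _ 1 (fun=> -1))
  (ext _ b a) (ext _ L l) (ext _ v u) (ext _ H h).
rewrite big_sumType big_ord1 /= mul1r; under eq_bigr do rewrite mulN1r.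
rewrite sumrN subr_ge0; apply=> [[]|[]|z]//.
rewrite big_sumType big_ord1 /= mul1r; under eq_bigr do rewrite mulN1r.
rewrite sumrN subr_ge0.
have [[k zk]|nz] := pselect (exists k, box (a k) (l k) (u k) (h k) z).
  rewrite (bigD1 k)//= big1 ?addr0.
    by rewrite !indicE mem_set// mem_set//; exact: sub zk.
  move=> k' /eqP kk'; rewrite indicE memNset// => zk'; apply: kk'.
  exact: disj zk' zk.
rewrite big1 => [|k _]; first by rewrite indicE.
by rewrite indicE memNset// => zk; apply: nz; exists k.
Qed.

(** The window of length [r] starts at [z - r], moved up to [a] if needed. It places a small pore
    next to a given point without leaving a box. *)
Lemma max_window (R : realType) (a L z r : R) : 0 < r <= L -> a <= z < a + L ->
  [/\ a <= Num.max a (z - r), Num.max a (z - r) + r <= a + L,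
    z - r <= Num.max a (z - r) & Num.max a (z - r) <= z].
Proof. by move=> rL az; case: (leP a (z - r)) => az'; split; lra. Qed.

Lemma bernoulli_ineq (R : realType) (x : R) (m : nat) : 0 <= x <= 1 ->
  1 - m%:R * x <= (1 - x) ^+ m.
Proof.
move=> /andP[x0 x1]; elim: m => [|m IHm]; first by rewrite mul0r subr0 expr0.
rewrite exprS -natr1.
have : (1 - x) * (1 - m%:R * x) <= (1 - x) * (1 - x) ^+ m by rewrite ler_wpM2l// subr_ge0.
have : 0 <= m%:R * x * x by rewrite !mulr_ge0.
lra.
Qed.

(* Half of [l `^ p] is the least height of a valid parabolic rectangle of side
   [l], so every free one of side at least [l] contains such a pore. *)
Definition has_pore (R : realType) (n : nat) (p : R) (E : set ('rV[R]_n * R))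
    (l : R) (A : set ('rV[R]_n * R)) : Prop :=
  exists (a : 'rV[R]_n) (u : R),
    box a l u (l `^ p / 2) `<=` A /\ E_free E (box a l u (l `^ p / 2)).

(** Some free rectangle reaches a point at relative distance [2 * eps] from the faces of the earlier
    box. Half of this margin absorbs the translation to [x'] and [t'], the other half the extent of
    the new pore. *)
Lemma has_pore_step (R : realType) (n : nat) (p : R) (d : nat)
    (E : set ('rV[R]_n * R)) (c delta theta eps eta s l t t' : R)
    (x x' : 'rV[R]_n) :
  (1 <= n)%N -> 1 < p -> (1 <= d)%N -> ln 9 / ln 2 <= d%:R * p ->
  0 < c < 1 -> 0 < delta < 1 -> weakly_porous p d c delta theta E ->
  eps = c / (8 * n.+1%:R) -> eta = eps * (delta / 8 / 2 ^+ d) ->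
  0 < l <= s ->
  has_pore p E l (box x s t (s `^ p)) ->
  (forall i, `|x' 0 i - x 0 i| <= eps * s) ->
  `|t' - (t - theta * s `^ p)| <= eps * s `^ p ->
  has_pore p E (eta * l) (box x' s t' (s `^ p)).
Proof.
move=> n1 p1 d1 dp /andP[c0 c1] delta01 wp epsE etaE /andP[l0 ls] [a [u [sub free]]] xx' tt'.
have s0 : 0 < s by exact: lt_le_trans ls.
have sp0 : 0 < s `^ p by rewrite powR_gt0.
have n8 : 0 < 8 * n.+1%:R :> R by rewrite mulr_gt0.
have eps0 : 0 < eps by rewrite epsE divr_gt0.
have epsn : n.+1%:R * eps = c / 8.
  rewrite epsE; have : n.+1%:R != 0 :> R by rewrite pnatr_eq0.
  by move: (n.+1%:R : R) => N N0; field.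
have eps8 : eps <= 1 / 8.
  have : eps <= n.+1%:R * eps by rewrite ler_peMl ?(ltW eps0)// ler1n.
  lra.
have /andP[delta0 delta1] := delta01.
pose e1 := delta / 8 / 2 ^+ d.
have e10 : 0 < e1 by rewrite divr_gt0 ?exprn_gt0//; lra.
have e11 : e1 <= 1.
  rewrite ler_pdivrMr ?exprn_gt0// mul1r (@le_trans _ _ 1)//; first lra.
  by rewrite exprn_ege1// ler1n.
have eta0 : 0 < eta by rewrite etaE mulr_gt0.
have eta_e1 : eta <= e1 by rewrite etaE ler_piMl ?(ltW e10)//; lra.
have eta_eps : eta <= eps by rewrite etaE ler_piMr ?(ltW eps0).
pose t0 := t - theta * s `^ p.
(* With truncation 0 the height is exactly s^p, so the [theta]-shift of [B] is the given box. *)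
pose B : prect R n := PRect (\row_i (x 0 i + s / 2)) (t0 + s `^ p) s 0.
have vB : prect_valid B by split=> //=; lra.
have cB : pcorner B = x by apply/rowP => i; rewrite !mxE /=; lra.
have ltB : l_t p B = s `^ p by rewrite /l_t /= subr0 mul1r.
have bB : pbot p B = t0 by rewrite /pbot /= addrK.
have BE : prect_set p B = box x s t0 (s `^ p) by rewrite prect_set_box cB ltB bB.
have BtE : prect_set p (pshift p theta B) = box x s t (s `^ p).
  rewrite prect_set_box [pcorner _]cB [l_t _ _]ltB; congr box.
  by rewrite /pbot /= ltB /t0; lra.
rewrite -BtE in sub.
have ls' : 0 < l <= l_x B by rewrite l0.
have [T [S [SB Sdisj Sfree Sl Sc]]] :=
  porous_family n1 p1 d1 dp delta01 wp vB ls' sub free.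
have vS k := dyadic_valid dp vB (SB k).
have volB : vol p B = s ^+ n * s `^ p by rewrite /vol ltB.
(* The core of [B], with relative margin [2 * eps] on every side. By the Bernoulli inequality the
   value of [eps] makes it fill at least [1 - c / 2] of [B]. *)
pose xC : 'rV[R]_n := \row_i (x 0 i + 2 * eps * s).
pose sC := s * (1 - 4 * eps); pose tC := t0 + 2 * eps * s `^ p.
pose hC := s `^ p * (1 - 4 * eps).
have sC0 : 0 <= sC by rewrite mulr_ge0 ?(ltW s0)//; lra.
have hC0 : 0 <= hC by rewrite mulr_ge0 ?(ltW sp0)//; lra.
have es0 : 0 < eps * s by rewrite mulr_gt0.
have esp0 : 0 < eps * s `^ p by rewrite mulr_gt0.
have volC : (1 - c / 2) * vol p B <= sC ^+ n * hC.
  rewrite volB /sC /hC exprMn mulrACA -exprSr mulrC ler_pM2l; last first.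
    by rewrite mulr_gt0 ?exprn_gt0.
  apply: le_trans (_ : _ <= 1 - n.+1%:R * (4 * eps)) _; first by lra.
  by apply: bernoulli_ineq; lra.
have CB : box xC sC tC hC `<=` box x s t0 (s `^ p).
  move=> y [yx yt]; split=> [i|]; last by move: yt; rewrite /tC /hC; lra.
  have xCi : xC 0 i = x 0 i + 2 * eps * s by rewrite mxE.
  by have := yx i; rewrite xCi /sC; lra.
have [k [z [zS zC]]] : exists k z, prect_set p (S k) z /\ box xC sC tC hC z.
  (* Otherwise the core and the family would be disjoint inside [B], with total volume at least
     [1 + c / 2] times that of [B]. *)
  apply: contrapT => none.
  pose ext A (y : A) (f : T -> A) (k : 'I_1 + T) := if k is inr k' then f k' else y.
  have := @box_packing R n ('I_1 + T)%type (ext _ xC (fun k => pcorner (S k)))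
    (ext _ sC (fun k => l_x (S k))) (ext _ tC (fun k => pbot p (S k)))
    (ext _ hC (fun k => l_t p (S k))) x s t0 (s `^ p).
  rewrite big_sumType big_ord1 /= -volB -[X in _ + X]/(\sum_k vol p (S k)).
  have vB0 := vol_gt0 p vB.
  have cvB : 0 < c * vol p B by rewrite mulr_gt0.
  suff : ~ (sC ^+ n * hC + \sum_k vol p (S k) <= vol p B).
    move=> /[swap] H; apply; apply: H.
    - by case=> //= k; exact/ltW/lx_gt0.
    - by case=> //= k; have [/ltW] := l_t_bounds p (vS k).
    - exact: ltW.
    - exact: ltW.
    - move=> [k|k] [k'|k'] y /=; first by rewrite !ord1.
      + by move=> yC; rewrite -prect_set_box => yS; case: none; exists k', y.
      + by rewrite -prect_set_box => yS yC; case: none; exists k, y.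
      + by rewrite -!prect_set_box => yk yk'; rewrite (Sdisj _ _ _ yk yk').
    - by case=> //= k; rewrite -prect_set_box -BE; exact: dyadic_sub (SB k).
  lra.
have lS := Sl k; rewrite -/e1 in lS.
have [_ ltS _] := l_t_bounds p (vS k).
have r0 : 0 < eta * l by rewrite mulr_gt0.
(* Of the two factors of [eta], [e1] fits the new pore into [S k] and [eps] keeps it within the
   margin. *)
have rS : eta * l <= l_x (S k) by apply: le_trans lS; rewrite ler_pM2r.
have rs : eta * l <= eps * s by apply: ler_pM => //; exact: ltW.
have p0 : 0 < p by lra.
have rpS : (eta * l) `^ p <= l_x (S k) `^ p.
  by apply: ge0_ler_powR; rewrite ?nnegrE// ?(ltW p0) ?(ltW r0)// ltW// (lt_le_trans r0).
have rps : (eta * l) `^ p <= eps * s `^ p.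
  rewrite powRM ?(ltW eta0) ?(ltW l0)//; apply: ler_pM; rewrite ?powR_ge0//.
    by apply: le_trans eta_eps; apply: powR_le_base; lra.
  by apply: ge0_ler_powR; rewrite ?nnegrE// ?(ltW p0) ?(ltW l0) ?(ltW s0).
pose a' : 'rV[R]_n := \row_i Num.max (pcorner (S k) 0 i) (z.1 0 i - eta * l).
pose u' := Num.max (pbot p (S k)) (z.2 - (eta * l) `^ p / 2).
have rp0 : 0 < (eta * l) `^ p by rewrite powR_gt0.
move: zS; rewrite prect_set_box => -[zSx zSt]; have [zCx zCt] := zC.
have ax i : [/\ pcorner (S k) 0 i <= a' 0 i,
    a' 0 i + eta * l <= pcorner (S k) 0 i + l_x (S k),
    z.1 0 i - eta * l <= a' 0 i & a' 0 i <= z.1 0 i].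
  have -> : a' 0 i = Num.max (pcorner (S k) 0 i) (z.1 0 i - eta * l) by rewrite mxE.
  by apply: max_window; [rewrite r0|].
have [ut1 ut2 ut3 ut4] : [/\ pbot p (S k) <= u',
    u' + (eta * l) `^ p / 2 <= pbot p (S k) + l_t p (S k),
    z.2 - (eta * l) `^ p / 2 <= u' & u' <= z.2].
  by apply: max_window => //; lra.
exists a', u'; split.
  move=> y [yx yt]; split=> [i|].
    have xCi : xC 0 i = x 0 i + 2 * eps * s by rewrite mxE.
    have [_ _ a3 a4] := ax i; move: (yx i) (zCx i) (xx' i) a3 a4 rs.
    rewrite xCi /sC ler_norml; clear; lra.
  move: yt zCt tt' ut3 ut4 rps rp0; rewrite /tC /hC -/t0 ler_norml; clear; lra.
apply/seteqP; split=> // y [[yx yt] yE].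
rewrite -(Sfree k); split=> //; rewrite prect_set_box; split=> [i|].
  by have [a1 a2 _ _] := ax i; move: (yx i) a1 a2; clear; lra.
by move: yt ut1 ut2; clear; lra.
Qed.

(** * Chains of propagation steps *)

Lemma norm_split (R : realType) (v e : R) (N : nat) : `|v| <= N.+1%:R * e ->
  `|v / N.+1%:R| <= e /\ `|v - v / N.+1%:R| <= N%:R * e.
Proof.
move=> ve; have N0 : 0 < N.+1%:R :> R by rewrite ltr0n.
have h : `|v / N.+1%:R| <= e.
  by rewrite normrM normfV (ger0_norm (ltW N0)) ler_pdivrMr// mulrC.
split=> //; rewrite (_ : v - _ = N%:R * (v / N.+1%:R)).
  by rewrite normrM normr_nat ler_wpM2l.
have vE : v = N.+1%:R * (v / N.+1%:R) by rewrite mulrC divfK// gt_eqF.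
by rewrite {1}vE -natr1 mulrDl mul1r addrK.
Qed.

(** The displacement in space, and the deviation [D] in time from a drift of theta s^p per step, are
    spread evenly: the last step takes a share 1 / (N + 1) and the induction takes the other [N]
    shares. *)
Lemma has_pore_chain (R : realType) (n : nat) (p theta eps eta s : R)
    (E : set ('rV[R]_n * R)) :
  0 <= s -> 0 < eta <= 1 ->
  (forall (l t t' : R) (x x' : 'rV[R]_n),
     0 < l <= s -> has_pore p E l (box x s t (s `^ p)) ->
     (forall i, `|x' 0 i - x 0 i| <= eps * s) ->
     `|t' - (t - theta * s `^ p)| <= eps * s `^ p ->
     has_pore p E (eta * l) (box x' s t' (s `^ p))) ->
  forall (N : nat) (l t t' : R) (x x' : 'rV[R]_n),
     0 < l <= s -> has_pore p E l (box x s t (s `^ p)) ->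
     (forall i, `|x' 0 i - x 0 i| <= N%:R * (eps * s)) ->
     `|t' - (t - N%:R * (theta * s `^ p))| <= N%:R * (eps * s `^ p) ->
     has_pore p E (eta ^+ N * l) (box x' s t' (s `^ p)).
Proof.
move=> s0 /andP[eta0 eta1] step; elim=> [|N IHN] l t t' x x' /andP[l0 ls] pore xx' tt'.
  have -> : x' = x.
    apply/rowP => i; apply/eqP; rewrite -subr_eq0 -normr_le0.
    by have := xx' i; rewrite mul0r.
  have -> : t' = t.
    by apply/eqP; rewrite -subr_eq0 -normr_le0; move: tt'; rewrite !mul0r subr0.
  by rewrite expr0 mul1r.
rewrite exprS -mulrA.
pose x'' : 'rV[R]_n := \row_i (x' 0 i - (x' 0 i - x 0 i) / N.+1%:R).
pose D := t' - (t - N.+1%:R * (theta * s `^ p)).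
pose t'' := t' + theta * s `^ p - D / N.+1%:R.
have [D1 D2] := norm_split tt'; rewrite -/D in D1 D2.
have etaN : 0 < eta ^+ N <= 1 by rewrite exprn_gt0//= exprn_ile1// ltW.
apply: (step _ t'' _ x''); last 1 first.
- by rewrite (_ : _ - _ = D / N.+1%:R)// /t''; ring.
- have /andP[e0 e1] := etaN; rewrite mulr_gt0//= (le_trans _ ls)//.
  by rewrite ler_piMl// ltW.
- apply: (IHN _ t _ x) => // [|i|]; first by rewrite l0.
    have [_] := norm_split (xx' i).
    by rewrite (_ : x'' 0 i - x 0 i = (x' 0 i - x 0 i) - (x' 0 i - x 0 i) / N.+1%:R)// mxE; ring.
  rewrite (_ : _ - _ = D - D / N.+1%:R)// /t'' /D -natr1.
  by move: (_ / _) => w; ring.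
- move=> i; have [+ _] := norm_split (xx' i).
  by rewrite (_ : x' 0 i - x'' 0 i = (x' 0 i - x 0 i) / N.+1%:R)// mxE; ring.
Qed.

(** * Gluing families over dyadic cells *)

(** Families in distinct children are disjoint and the volumes of the children add up to that of
    [P], so the fraction [c] is kept without loss. *)
Lemma pore_family_children (R : realType) (n : nat) (p : R) (d : nat)
    (E : set ('rV[R]_n * R)) (c : R) (A : prect R n -> Prop) (P : prect R n) :
  ln 9 / ln 2 <= d%:R * p -> prect_valid P ->
  (forall Q, dyadic1 p d P Q -> pore_family p d E c A Q) ->
  pore_family p d E c A P.
Proof.
move=> dp vP fam.
pose k := nb_t p d (pgam P).
pose I : finType := ({ffun 'I_n -> 'I_(2 ^ d)} * 'I_k)%type.
pose C (i : I) := child p P i.1 i.2.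
have CP i : dyadic1 p d P (C i) by exists i.1, i.2.
pose T i : finType := projT1 (cid (fam _ (CP i))).
pose S i : T i -> prect R n := projT1 (cid (projT2 (cid (fam _ (CP i))))).
have H i : [/\ forall x, dyadic p d (C i) (S i x),
    forall x x' z, prect_set p (S i x) z -> prect_set p (S i x') z -> x = x',
    forall x, E_free E (prect_set p (S i x)), forall x, A (S i x) &
    c * vol p (C i) <= \sum_x vol p (S i x)].
  exact: projT2 (cid (projT2 (cid (fam _ (CP i))))).
have HS i x : dyadic p d (C i) (S i x) by have [+ _ _ _ _] := H i; exact.
exists {i : I & T i}, (fun x => S (tag x) (tagged x)); split.
- by move=> [i x] /=; apply: dyadic_child (CP i) _; exact: HS.
- move=> [i x] [i' x'] z /= zx zx'.
  have ii' : i = i'.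
    have sub j y : prect_set p (S j y) `<=` prect_set p (C j).
      by apply: (dyadic_sub dp); [exact: dyadic1_valid dp vP (CP j)|exact: HS].
    have [m_eq j_eq] := child_disjoint dp vP (sub _ _ _ zx) (sub _ _ _ zx').
    case: i i' m_eq j_eq {x x' zx zx'} => [m j] [m' j'] /= m_eq j_eq.
    by congr (_, _); [apply/ffunP => y; rewrite m_eq|exact/val_inj].
  case: _ / ii' x' zx' => x' zx'; congr existT.
  by have [_ Hd _ _ _] := H i; exact: Hd zx zx'.
- by move=> [i x] /=; have [_ _ + _ _] := H i; exact.
- by move=> [i x] /=; have [_ _ _ + _] := H i; exact.
- have volC i : vol p (C i) = (l_x P / 2 ^+ d) ^+ n * (l_t p P / k%:R).
    by rewrite /vol child_lt//; case: vP.
  have k0 : k%:R != 0 :> R by rewrite pnatr_eq0 -lt0n nb_t_gt0.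
  have -> : vol p P = \sum_i vol p (C i).
    (* The children have equal volumes, and there are (2^d)^n k of them. *)
    rewrite (eq_bigr _ (fun i _ => volC i)) sumr_const card_prod card_ffun !card_ord.
    rewrite -[_ *+ (_ * _)]mulr_natr natrM !natrX expr_div_n /vol.
    by field; rewrite k0 !expf_neq0.
  have -> : \sum_x vol p (S (tag x) (tagged x)) = \sum_i \sum_x vol p (S i x).
    by rewrite sig_big_dep.
  by rewrite mulr_sumr; apply: ler_sum => i _; have [_ _ _ _] := H i.
Qed.

Lemma pore_family_gen (R : realType) (n : nat) (p : R) (d : nat)
    (E : set ('rV[R]_n * R)) (c : R) (A : prect R n -> Prop) (P : prect R n) i :
  ln 9 / ln 2 <= d%:R * p -> prect_valid P ->
  (forall Q, dyadic_gen p d i P Q -> pore_family p d E c A Q) ->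
  pore_family p d E c A P.
Proof.
move=> dp vP; elim: i => [|i IHi] fam; first exact: fam.
apply: IHi => Q QP; apply: pore_family_children => //.
  exact: dyadic_gen_valid QP.
by move=> S SQ; apply: fam; exists Q.
Qed.

(** * Transport of the largest free rectangle *)

(** The dominant term is of order lam^(p-1), which is small for small [lam] as p > 1. So [lam] is
    found by prescribing the value [w] of lam^(p-1). *)
Lemma exists_scale (R : realType) (p K g lam0 theta : R) :
  1 < p -> 0 < K -> 0 < g -> 0 < lam0 -> 0 < theta ->
  exists lam : R, [/\ 0 < lam, lam <= lam0, lam <= 1 &
    (1 + (theta + lam^-1) * K) * (theta * lam `^ p) <= g].
Proof.
move=> p1 K0 g0 lam00 theta0.
have q0 : 0 < p - 1 by rewrite subr_gt0.
pose m := Num.min lam0 1.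
have m0 : 0 < m by rewrite /m lt_min lam00 ltr01.
have B0 : 0 < theta * (1 + (theta + 1) * K).
  by rewrite mulr_gt0// addr_gt0// mulr_gt0// addr_gt0.
pose w := Num.min (m `^ (p - 1)) (g / (theta * (1 + (theta + 1) * K))).
have w0 : 0 < w by rewrite /w lt_min powR_gt0// divr_gt0.
pose lam := w `^ (p - 1)^-1.
have lam_gt0 : 0 < lam by rewrite powR_gt0.
have lamw : lam `^ (p - 1) = w by rewrite /lam -powRrM mulVf ?gt_eqF// powRr1// ltW.
have lamm : lam <= m.
  have -> : m = (m `^ (p - 1)) `^ (p - 1)^-1.
    by rewrite -powRrM mulfV ?gt_eqF// powRr1// ltW.
  apply: ge0_ler_powR; rewrite ?nnegrE ?powR_ge0 ?invr_ge0 ?(ltW q0) ?(ltW w0)//.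
  by rewrite /w ge_min lexx.
have [lam0' lam1] : lam <= lam0 /\ lam <= 1.
  by apply/andP; move: lamm; rewrite /m le_min.
exists lam; split=> //.
have -> : lam `^ p = lam * w.
  by rewrite -lamw mulr_powRB1 ?(ltW lam_gt0)//; lra.
have wg : w * (theta * (1 + (theta + 1) * K)) <= g.
  by rewrite -ler_pdivlMr// /w ge_min lexx orbT.
apply: le_trans wg.
rewrite (_ : _ * (theta * _) = w * (theta * (lam + (theta * lam + 1) * K))); last first.
  by field; rewrite gt_eqF.
rewrite ler_pM2l// ler_pM2l//.
have : theta * lam <= theta by rewrite ler_piMr// ltW.
move=> tl; have : (theta * lam + 1) * K <= (theta + 1) * K by rewrite ler_pM2r//; lra.
lra.
Qed.

(** The start of the chain: the pore at the lower corner of [M] is shrunk by [lam] to fit into a box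
    of the step scale [s]. *)
Lemma has_pore_scaled (R : realType) (n : nat) (p lam : R) (E : set ('rV[R]_n * R))
    (M : prect R n) (s : R) :
  1 < p -> prect_valid M -> E_free E (prect_set p M) -> 0 < lam <= 1 ->
  lam * l_x M <= s ->
  has_pore p E (lam * l_x M) (box (pcorner M) s (pbot p M) (s `^ p)).
Proof.
move=> p1 vM free /andP[lam0 lam1] ls.
have M0 := lx_gt0 vM; have [_ ltM _] := l_t_bounds p vM.
have l0 : 0 < lam * l_x M by rewrite mulr_gt0.
have lM : lam * l_x M <= l_x M by rewrite ler_piMl// ltW.
have p0 : 0 < p by lra.
have pow_le (x y : R) : 0 < x -> x <= y -> x `^ p <= y `^ p.
  move=> x0 xy; apply: ge0_ler_powR; rewrite ?nnegrE ?(ltW p0) ?(ltW x0)//.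
  exact: le_trans (ltW x0) xy.
have h1 := pow_le _ _ l0 lM; have h2 := pow_le _ _ l0 ls.
have lp0 : 0 < (lam * l_x M) `^ p by rewrite powR_gt0.
exists (pcorner M), (pbot p M); split.
  by move=> y [yx yt]; split=> [i|]; [have := yx i|]; lra.
apply/seteqP; split=> // y [[yx yt] yE]; rewrite -free; split=> //.
by rewrite prect_set_box; split=> [i|]; [have := yx i|]; lra.
Qed.

(** A chain at scale [s = lam * l_x P0] carries a pore of [M] into the [theta]-shift of [Q]. Weak
    porosity at [Q] then costs one more factor, whence the [.+1] in the exponent. *)
Lemma porous_family_transfer (R : realType) (n : nat) (p : R) (d : nat)
    (c delta theta psi eps eta lam : R) (E : set ('rV[R]_n * R))
    (P0 Q M : prect R n) :
  (1 <= n)%N -> 1 < p -> (1 <= d)%N -> ln 9 / ln 2 <= d%:R * p ->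
  0 < c < 1 -> 0 < delta < 1 -> 1 < theta -> 1 < psi ->
  weakly_porous p d c delta theta E ->
  eps = c / (8 * n.+1%:R) -> eta = eps * (delta / 8 / 2 ^+ d) ->
  0 < lam <= 1 ->
  (1 + (theta + lam^-1) * eps^-1) * (theta * lam `^ p) <= (psi - 1) / 4 ->
  prect_valid P0 -> prect_valid Q -> prect_valid M ->
  prect_set p Q `<=` prect_set p P0 ->
  prect_set p M `<=` prect_set p (pshift p psi P0) ->
  E_free E (prect_set p M) ->
  theta * l_x Q `^ p <= (psi - 1) / 4 * l_x P0 `^ p ->
  lam * l_x P0 <= l_x Q / 2 ->
  pore_family p d E c
    (fun S => eta ^+ (Num.truncn ((psi + 1) / (theta * lam `^ p))).+1
              * (lam * l_x M) <= l_x S) Q.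
Proof.
move=> n1 p1 d1 dp c01 delta01 theta1 psi1 wp epsE etaE /andP[lam0 lam1] lamP.
move=> vP0 vQ vM QP0 MP0 Mfree thetaQ lamQ.
have /andP[c0 c1] := c01; have /andP[delta0 delta1] := delta01.
have p0 : 0 < p by lra.
have theta0 : 0 < theta by lra.
have [L0 Q0 M0] : [/\ 0 < l_x P0, 0 < l_x Q & 0 < l_x M] by split; exact: lx_gt0.
have eps0 : 0 < eps by rewrite epsE divr_gt0// mulr_gt0.
have eps1 : eps <= 1.
  rewrite epsE ler_pdivrMr ?mulr_gt0// mul1r (le_trans (ltW c1))//.
  by rewrite -natrM ler1n.
pose e1 := delta / 8 / 2 ^+ d.
have e10 : 0 < e1 by rewrite divr_gt0 ?exprn_gt0//; lra.
have e11 : e1 <= 1.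
  rewrite ler_pdivrMr ?exprn_gt0// mul1r (@le_trans _ _ 1)//; first lra.
  by rewrite exprn_ege1// ler1n.
have eta0 : 0 < eta by rewrite etaE mulr_gt0.
have eta_e1 : eta <= e1 by rewrite etaE ler_piMl ?(ltW e10).
have eta1 : eta <= 1 by exact: le_trans e11.
pose s := lam * l_x P0.
have s0 : 0 < s by rewrite mulr_gt0.
have sp0 : 0 < s `^ p by rewrite powR_gt0.
have LP0 : 0 < l_x P0 `^ p by rewrite powR_gt0.
have lp0 : 0 < lam `^ p by rewrite powR_gt0.
have spE : s `^ p = lam `^ p * l_x P0 `^ p by rewrite powRM ?(ltW lam0) ?(ltW L0).
have [ltP0 ltP1 ltP2] := l_t_bounds p vP0.
have [ltQ0 ltQ1 ltQ2] := l_t_bounds p vQ.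
have [ltM0 _ _] := l_t_bounds p vM.
have [Qx [Qt1 Qt2]] : (forall i, pcorner P0 0 i <= pcorner Q 0 i /\
      pcorner Q 0 i + l_x Q <= pcorner P0 0 i + l_x P0) /\
    (pbot p P0 <= pbot p Q /\ pbot p Q + l_t p Q <= pbot p P0 + l_t p P0).
  by move: QP0; rewrite !prect_set_box; exact: box_subset_coord.
have shiftE : prect_set p (pshift p psi P0) =
    box (pcorner P0) (l_x P0) (pbot p P0 + psi * l_t p P0) (l_t p P0).
  by rewrite prect_set_box; congr box; rewrite /pbot /= addrAC.
have [Mx [Mt1 Mt2]] : (forall i, pcorner P0 0 i <= pcorner M 0 i /\
      pcorner M 0 i + l_x M <= pcorner P0 0 i + l_x P0) /\
    (pbot p P0 + psi * l_t p P0 <= pbot p M /\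
     pbot p M + l_t p M <= pbot p P0 + psi * l_t p P0 + l_t p P0).
  by move: MP0; rewrite shiftE prect_set_box; exact: box_subset_coord.
have ML : l_x M <= l_x P0 by have := Mx (Ordinal n1); lra.
(* [t'] is the bottom of the [theta]-shift of [Q], and [tau] the time the chain has to cover. *)
pose t' := pbot p Q + theta * l_t p Q.
pose tau := pbot p M - t'.
have thQ0 : 0 < theta * l_t p Q by rewrite mulr_gt0.
have thQ : theta * l_t p Q <= (psi - 1) / 4 * l_x P0 `^ p.
  by apply: le_trans thetaQ; rewrite ler_pM2l.
(* From the top of [Q] to the bottom of [M] there is at least (psi - 1) / 2 times L^p, with L the
   side of [P0]; the shift of [Q] uses up at most half of it. *)
have tau1 : (psi - 1) / 4 * l_x P0 `^ p <= tau.
  have : (psi - 1) * (l_x P0 `^ p / 2) <= (psi - 1) * l_t p P0.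
    by rewrite ler_pM2l// subr_gt0.
  by move: thQ Mt1 Qt2 ltQ0; rewrite /tau /t'; clear; lra.
have tau2 : tau <= (psi + 1) * l_x P0 `^ p.
  have : (psi + 1) * l_t p P0 <= (psi + 1) * l_x P0 `^ p.
    by rewrite ler_pM2l//; lra.
  by move: thQ0 Mt2 Qt1 ltM0; rewrite /tau /t'; clear; lra.
have tau0 : 0 <= tau.
  by apply: le_trans tau1; rewrite mulr_ge0 ?(ltW LP0)//; lra.
have ths0 : 0 < theta * s `^ p by rewrite mulr_gt0.
pose N := Num.truncn (tau / (theta * s `^ p)).
have q0 : 0 <= tau / (theta * s `^ p) by rewrite divr_ge0// ltW.
have /andP[N1 N2] := truncn_itv q0; rewrite -/N in N1 N2.
rewrite ler_pdivlMr// in N1; rewrite ltr_pdivrMr// -natr1 in N2.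
have Nlam : (theta + lam^-1) * eps^-1 <= N%:R.
  rewrite -(ler_pM2r ths0) -(lerD2l (theta * s `^ p)).
  rewrite -[X in X + _ <= _]mul1r -mulrDl spE.
  have : (1 + (theta + lam^-1) * eps^-1) * (theta * lam `^ p) * l_x P0 `^ p
       <= (psi - 1) / 4 * l_x P0 `^ p by rewrite ler_pM2r.
  move: tau1 N2; rewrite mulrDl mul1r spE -!mulrA; lra.
(* The first bound lets [N] steps absorb the remainder of [tau], which is below theta s^p; the
   second lets them cross the side of [P0]. *)
have Neps : theta <= N%:R * eps /\ lam^-1 <= N%:R * eps.
  have lamV : 0 < lam^-1 by rewrite invr_gt0.
  by move: Nlam; rewrite ler_pdivrMr// => h; split; lra.
have ls : 0 < lam * l_x M <= s by rewrite mulr_gt0//= ler_pM2l.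
have pore0 := has_pore_scaled p1 vM Mfree (introT andP (conj lam0 lam1)) (proj2 (andP ls)).
have pore1 : has_pore p E (eta ^+ N * (lam * l_x M)) (box (pcorner Q) s t' (s `^ p)).
  apply: (has_pore_chain (theta := theta) (eps := eps)) pore0 _ _ => //.
  - exact: ltW.
  - by rewrite eta0.
  - move=> l t1 t2 x1 x2 ll pl xx tt.
    exact: has_pore_step n1 p1 d1 dp c01 delta01 wp epsE etaE ll pl xx tt.
  - move=> i; have [N_ h] := Neps.
    have : l_x P0 <= N%:R * (eps * s).
      have : lam^-1 * s <= N%:R * eps * s by rewrite ler_pM2r.
      by rewrite /s mulKf ?gt_eqF// -mulrA.
    by have := Qx i; have := Mx i; move: M0 Q0; rewrite ler_norml; clear; lra.
  - have [h _] := Neps.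
    have : theta * s `^ p <= N%:R * (eps * s `^ p) by rewrite mulrA ler_pM2r.
    by move: N1 N2; rewrite ler_norml /tau; clear; lra.
have [a [u [sub free]]] := pore1.
pose r := eta ^+ N * (lam * l_x M).
have sQ : s <= l_x Q by move: lamQ Q0; rewrite /s; clear; lra.
have rs : r <= s.
  have /andP[h1 h2] := ls; apply: le_trans h2.
  by rewrite ler_piMl ?(ltW h1)// exprn_ile1// ltW.
have r0 : 0 < r by have /andP[h1 _] := ls; rewrite mulr_gt0// exprn_gt0.
(* Truncation may halve the height of [Q]; the factor 2 in [lamQ] compensates for it. *)
have spQ : s `^ p <= l_t p Q.
  apply: le_trans ltQ1; have : s `^ p <= (2^-1 * l_x Q) `^ p.
    apply: ge0_ler_powR; rewrite ?nnegrE ?(ltW p0) ?(ltW s0)//.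
      by rewrite mulr_ge0 ?invr_ge0 ?(ltW Q0).
    by rewrite mulrC.
  move=> /le_trans; apply; rewrite powRM ?invr_ge0 ?(ltW Q0)// mulrC.
  rewrite ler_pM2l ?powR_gt0//; apply: powR_le_base; first exact: ltW.
  by rewrite invr_ge0 ler0n invf_le1// ler1n.
have sub' : box (pcorner Q) s t' (s `^ p) `<=` prect_set p (pshift p theta Q).
  have -> : prect_set p (pshift p theta Q) = box (pcorner Q) (l_x Q) t' (l_t p Q).
    by rewrite prect_set_box; congr box; rewrite /pbot /t' /= addrAC.
  by move=> y [yx yt]; split=> [i|]; [have := yx i|]; lra.
have rQ : 0 < r <= l_x Q by rewrite r0 (le_trans rs).
have := porous_family n1 p1 d1 dp delta01 wp vQ rQ (subset_trans sub sub') free.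
apply: pore_family_mono => S _; apply: le_trans.
have /andP[lM0 _] := ls; rewrite -/e1 /r [X in _ <= X]mulrA ler_pM2r//.
apply: (@le_trans _ _ (eta * eta ^+ N)); last by rewrite ler_pM2r// exprn_gt0.
(* By [tau2] the number of steps is bounded independently of the rectangles and of [E], so the loss
   is uniform. *)
rewrite exprS ler_pM2l// ler_wiXn2l ?(ltW eta0)//.
rewrite truncn_ge_nat; last by rewrite divr_ge0 ?mulr_ge0 ?(ltW theta0) ?(ltW lp0)//; lra.
rewrite ler_pdivlMr ?mulr_gt0//.
rewrite -(ler_pM2r LP0) -!mulrA -spE.
exact: le_trans N1 tau2.
Qed.

(** Weak porosity at [P] itself gives free cells of positive total volume, so there is at least one
    and the default [set0] does not occur. *)
Lemma largest_free_wp (R : realType) (n : nat) (p : R) (d : nat)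
    (c delta theta : R) (E : set ('rV[R]_n * R)) (P : prect R n) :
  (1 <= n)%N -> (1 <= d)%N -> ln 9 / ln 2 <= d%:R * p -> 0 < c ->
  weakly_porous p d c delta theta E -> prect_valid P ->
  exists2 M, max_free p d E P M & largest_free p d E P = prect_set p M.
Proof.
move=> n1 d1 dp c0 [_ _ wp] vP.
have /(free_familyE dp _ _ _ vP)[T [S [SP _ Sfree _ Sc]]] := wp _ vP.
have [k _|T0] := pickP (fun _ : T => true).
  by have [M [MP ME _]] := largest_free_ge n1 d1 dp vP (SP k) (Sfree k); exists M.
move: Sc; rewrite big_pred0// leNgt mulr_gt0//; exact: vol_gt0.
Qed.

(** * Choice of the constants and conclusion *)

Theorem corollary5p2 (R : realType) (n : nat) (p : R) (d : nat)
    (c delta theta psi : R) :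
  (1 <= n)%N -> 1 < p -> (1 <= d)%N -> ln 9 / ln 2 <= d%:R * p ->
  0 < c < 1 -> 0 < delta < 1 -> 1 < theta -> 1 < psi ->
  exists sigma : R, 0 < sigma < 1 /\
    forall E : set ('rV[R]_n * R),
      weakly_porous p d c delta theta E ->
      weakly_porous p d c sigma psi E /\
      forall P0 : prect R n, prect_valid P0 ->
        forall P : prect R n, dyadic1 p d P0 P ->
          free_family p d E c
            (sigma%:E * lebesgue_xt (largest_free p d E (pshift p psi P0)))%E P.
Proof.
move=> n1 p1 d1 dp c01 delta01 theta1 psi1.
have /andP[c0 c1] := c01; have /andP[delta0 delta1] := delta01.
have p0 : 0 < p by lra.
have theta0 : 0 < theta by lra.
pose g := (psi - 1) / 4.
have g0 : 0 < g by rewrite /g; lra.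
(* [i] is the depth of the cells [Q]: so deep that shifting them by [theta] uses little of the time
   gap before the [psi]-shift of [P0]. *)
have [i /andP[_ i2]] : exists i,
    Num.min 1 (4 * g / theta) / 4 / 2 ^+ d <= 1 / 2 ^+ (d * i)
      <= Num.min 1 (4 * g / theta) / 4.
  apply: exists_gen => //.
  rewrite ge_min lexx andbT lt_min ltr01 /=.
  by rewrite divr_gt0// mulr_gt0.
have thetai : theta / 2 ^+ (d * i) <= g.
  have : 1 / 2 ^+ (d * i) <= g / theta.
    apply: le_trans i2 _; rewrite ler_pdivrMr//. rewrite ge_min; apply/orP; right.
    by rewrite -mulrA mulrC.
  by rewrite ler_pdivlMr// mul1r mulrC.
pose eps := c / (8 * n.+1%:R); pose eta := eps * (delta / 8 / 2 ^+ d).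
have eps0 : 0 < eps by rewrite divr_gt0// mulr_gt0.
have eps1 : eps <= 1.
  rewrite ler_pdivrMr ?mulr_gt0// mul1r (le_trans (ltW c1))//.
  by rewrite -natrM ler1n.
have eta01 : 0 < eta <= 1.
  have e0 : 0 < delta / 8 / 2 ^+ d by rewrite divr_gt0 ?exprn_gt0//; lra.
  rewrite mulr_gt0//= mulr_ile1 ?(ltW eps0) ?(ltW e0)//.
  rewrite ler_pdivrMr ?exprn_gt0// mul1r (@le_trans _ _ 1)//; first lra.
  by rewrite exprn_ege1// ler1n.
(* The bound is half the side ratio of generation [i.+1], so that the step scale fits into cells of
   both generations [i] and [i.+1]. *)
have [lam [lam0 lami lam1 lamP]] : exists lam : R, [/\ 0 < lam,
    lam <= (2 ^+ (d * i.+1))^-1 / 2, lam <= 1 &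
    (1 + (theta + lam^-1) * eps^-1) * (theta * lam `^ p) <= g].
  by apply: exists_scale => //; rewrite -?/g ?invr_gt0 ?divr_gt0 ?invr_gt0 ?exprn_gt0 ?subr_gt0.
pose K := (Num.truncn ((psi + 1) / (theta * lam `^ p))).+1.
pose rho := eta ^+ K * lam.
have /andP[eta0 eta1] := eta01.
have rho0 : 0 < rho by rewrite mulr_gt0// exprn_gt0.
have rho1 : rho <= 1.
  by rewrite mulr_ile1 ?(ltW lam0) ?exprn_ge0 ?(ltW eta0)// exprn_ile1// ltW.
(* Turns [rho * l_x M <= l_x S] into a bound on volumes; the 1/2 allows for the truncation of [S].
   No constant here involves [E]. *)
pose sigma := rho ^+ n * rho `^ p / 2.
have rp0 : 0 < rho `^ p by rewrite powR_gt0.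
have sigma0 : 0 < sigma by rewrite divr_gt0// mulr_gt0// exprn_gt0.
have sigma1 : sigma < 1.
  have : rho ^+ n * rho `^ p <= 1.
    have rn1 : rho ^+ n <= 1 by apply: exprn_ile1 => //; exact: ltW.
    have rp1 : rho `^ p <= 1.
      apply: (le_trans _ rho1); apply: powR_le_base; first exact: ltW.
      by rewrite rho1 andbT ltW.
    by apply: mulr_ile1 => //; [exact/exprn_ge0/ltW|exact: ltW].
  by rewrite /sigma; lra.
exists sigma; split=> [|E wp]; first by rewrite sigma0.
(* Serves both claims: [Q] has generation [i] in [P0] for weak porosity, and generation [i.+1] when
   it has generation [i] in a child of [P0]. *)
have main P0 Q : prect_valid P0 -> prect_valid Q ->
    prect_set p Q `<=` prect_set p P0 ->
    l_x P0 / 2 ^+ (d * i.+1) <= l_x Q <= l_x P0 / 2 ^+ (d * i) ->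
    pore_family p d E c (fun S =>
      sigma%:E * lebesgue_xt (largest_free p d E (pshift p psi P0))
        <= (vol p S)%:E)%E Q.
  move=> vP0 vQ QP0 /andP[Q1 Q2].
  have vP0' : prect_valid (pshift p psi P0) by [].
  have [M [MP0 Mfree _] ->] := largest_free_wp n1 d1 dp c0 wp vP0'.
  have vM := dyadic_valid dp vP0' MP0.
  have L0 := lx_gt0 vP0; have lQ0 := lx_gt0 vQ; have lM0 := lx_gt0 vM.
  rewrite lebesgue_xt_vol// -EFinM.
  have thetaQ : theta * l_x Q `^ p <= g * l_x P0 `^ p.
    have : l_x Q `^ p <= ((2 ^+ (d * i))^-1 * l_x P0) `^ p.
      apply: ge0_ler_powR; rewrite ?nnegrE ?(ltW p0) ?(ltW lQ0)//.
        by rewrite mulr_ge0 ?invr_ge0 ?exprn_ge0 ?(ltW L0).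
      by rewrite mulrC.
    rewrite powRM ?invr_ge0 ?exprn_ge0 ?(ltW L0)// => h.
    have h' : ((2 ^+ (d * i))^-1 : R) `^ p <= (2 ^+ (d * i))^-1.
      apply: powR_le_base; first exact: ltW.
      by rewrite invr_ge0 exprn_ge0//= invf_le1 ?exprn_gt0// exprn_ege1// ler1n.
    apply: le_trans (_ : theta * ((2 ^+ (d * i))^-1 * l_x P0 `^ p) <= _).
      rewrite ler_pM2l//; apply: le_trans h _.
      by rewrite ler_pM2r ?powR_gt0.
    by rewrite mulrA ler_pM2r ?powR_gt0.
  have lamQ : lam * l_x P0 <= l_x Q / 2.
    apply: le_trans (_ : (2 ^+ (d * i.+1))^-1 / 2 * l_x P0 <= _).
      by rewrite ler_pM2r.
    by rewrite mulrAC ler_pM2r// mulrC.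
  have lam01 : 0 < lam <= 1 by rewrite lam0.
  have := porous_family_transfer n1 p1 d1 dp c01 delta01 theta1 psi1 wp erefl erefl
    lam01 lamP vP0 vQ vM QP0 (dyadic_sub dp vP0' MP0) Mfree thetaQ lamQ.
  apply: pore_family_mono => S SQ; rewrite -/K mulrA -/eps -/eta -/rho lee_fin => rS.
  have vS := dyadic_valid dp vQ SQ.
  have /andP[S1 _] := vol_bounds p vS; have /andP[_ M2] := vol_bounds p vM.
  apply: le_trans S1.
  apply: le_trans (_ : sigma * (l_x M ^+ n * l_x M `^ p) <= _).
    by rewrite ler_pM2l.
  rewrite /sigma mulrAC ler_pM2r// mulrACA -exprMn -powRM ?(ltW rho0) ?(ltW lM0)//.
  have r0 : 0 < rho * l_x M by rewrite mulr_gt0.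
  apply: ler_pM; rewrite ?exprn_ge0 ?powR_ge0 ?(ltW r0)//.
    by rewrite lerXn2r ?nnegrE ?(ltW r0)// ltW// (lt_le_trans r0).
  by apply: ge0_ler_powR; rewrite ?nnegrE ?(ltW p0) ?(ltW r0)// ltW// (lt_le_trans r0).
have lx_gen P0 : 0 < l_x P0 -> l_x P0 / 2 ^+ (d * i.+1) <= l_x P0 / 2 ^+ (d * i).
  by move=> L0; rewrite gen_lx_le.
have [E0 Ecl _] := wp; split.
  split=> // P0 vP0; apply/free_familyE => //.
  apply: (@pore_family_gen _ _ _ _ _ _ _ _ i) => // Q QP0.
  have L0 := lx_gt0 vP0.
  apply: main => //; first exact: dyadic_gen_valid QP0.
    exact: dyadic_gen_sub QP0.
  by rewrite (dyadic_gen_lx QP0) lexx andbT lx_gen.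
move=> P0 vP0 P PP0; have vP := dyadic1_valid dp vP0 PP0.
apply/free_familyE => //.
apply: (@pore_family_gen _ _ _ _ _ _ _ _ i) => // Q QP.
have QP0 := dyadic_gen_child PP0 QP; have L0 := lx_gt0 vP0.
apply: main => //; first exact: dyadic_gen_valid QP0.
  exact: dyadic_gen_sub QP0.
by rewrite (dyadic_gen_lx QP0) lexx/= lx_gen.
Qed.
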